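(* Let $H$ be a generalized house or a generalized bull. Then the following problem is solvable in polynomial time: given a graph $G$, decide whether $H$ is an induced minor of $G$.
   Context: All graphs are finite, simple and undirected. A graph $H$ is an induced minor of $G$ if $H$ can be obtained from $G$ by deleting vertices and contracting edges. A generalized house is a graph consisting of a triangle on vertices $a,u,v$, a vertex $b$ adjacent to $u$, a vertex $c$ adjacent to $v$, and a path $R=b_1b_2\dots b_r$ with $r>1$, $b_1=b$ and $b_r=c$ (these being all its vertices and edges). A generalized bull is defined in the same way except that $R$ is replaced by two vertex-disjoint paths $R_b=b_1\dots b_s$ and $R_c=b_{s+1}\dots b_r$ with $1\le s<r$, $b=b_1$ and $c=b_r$ (so the edge $b_sb_{s+1}$ is absent). The graph $H$ is fixed, and polynomial time is measured in the size of $G$. *)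

(* Defs.v *)
From mathcomp Require Import all_boot.

Set Implicit Arguments.
Unset Strict Implicit.
Unset Printing Implicit Defensive.

Record sgraph := SGraph {
  svertex :> finType;
  sedge : rel svertex;
  sedge_sym : symmetric sedge;
  sedge_irr : irreflexive sedge }.

Notation "x -- y" := (sedge x y) (at level 30).

Definition isomorphic (G H : sgraph) : Prop :=
  exists2 f : G -> H, bijective f & forall x y : G, f x -- f y = x -- y.

Section VertexDeletion.
Variables (G : sgraph) (x : G).

Definition del_vertex_edge : rel {z : G | z != x} :=
  fun z w => val z -- val w.

Lemma del_vertex_sym : symmetric del_vertex_edge.
Proof. by move=> z w; apply: sedge_sym. Qed.

Lemma del_vertex_irr : irreflexive del_vertex_edge.
Proof. by move=> z; apply: sedge_irr. Qed.

Definition del_vertex : sgraph := SGraph del_vertex_sym del_vertex_irr.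

End VertexDeletion.

(* The contraction of an edge xy keeps the name x for the merged vertex and
   discards y; loops and parallel edges are dropped. *)
Section EdgeContraction.
Variables (G : sgraph) (x y : G).

Definition contract_edge_edge : rel {z : G | z != y} :=
  fun z w => (z != w) && [|| val z -- val w, (val z == x) && (y -- val w)
                           | (val w == x) && (y -- val z)].

Lemma contract_edge_sym : symmetric contract_edge_edge.
Proof.
move=> z w; rewrite /contract_edge_edge eq_sym [val z -- _]sedge_sym.
by congr (_ && (_ || _)); rewrite orbC.
Qed.

Lemma contract_edge_irr : irreflexive contract_edge_edge.
Proof. by move=> z; rewrite /contract_edge_edge eqxx. Qed.

Definition contract_edge : sgraph := SGraph contract_edge_sym contract_edge_irr.

End EdgeContraction.

Inductive induced_minor (H : sgraph) : sgraph -> Prop :=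
| induced_minor_iso (G : sgraph) :
    isomorphic G H -> induced_minor H G
| induced_minor_del (G : sgraph) (x : G) :
    induced_minor H (del_vertex x) -> induced_minor H G
| induced_minor_contract (G : sgraph) (x y : G) :
    x -- y -> induced_minor H (contract_edge x y) -> induced_minor H G.

(* [vs] lists every vertex of [G] exactly once, and the edges of [G] are the
   unordered pairs underlying [es]. *)
Definition consists_of (G : sgraph) (vs : seq G) (es : seq (G * G)) : Prop :=
  [/\ uniq vs, forall x : G, x \in vs
    & forall x y : G, x -- y = ((x, y) \in es) || ((y, x) \in es)].

Definition path_edges (T : Type) (s : seq T) : seq (T * T) :=
  zip s (behead s).

(* The path R is b :: R', so that its last vertex c is [last b R']. *)
Definition generalized_house (H : sgraph) : Prop :=
  exists (a u v b : H) (R' : seq H),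
    let R := b :: R' in
    let c := last b R' in
    1 < size R /\
    consists_of [:: a, u, v & R]
      ([:: (a, u); (a, v); (u, v); (u, b); (v, c)] ++ path_edges R).

(* Here R_b is b :: Rb' and R_c is d :: Rc', where d is b_{s+1}. *)
Definition generalized_bull (H : sgraph) : Prop :=
  exists (a u v b d : H) (Rb' Rc' : seq H),
    let Rb := b :: Rb' in
    let Rc := d :: Rc' in
    let c := last d Rc' in
    consists_of [:: a, u, v & Rb ++ Rc]
      ([:: (a, u); (a, v); (u, v); (u, b); (v, c)]
         ++ path_edges Rb ++ path_edges Rc).

(* Random access machines. A machine has registers and a memory, both indexed
   by nat and holding natural numbers; every instruction takes unit time.
   There is no multiplication, so that values have bit length linear in the time
   elapsed, and polynomial time on this machine coincides with polynomial
   time on Turing machines (Cook and Reckhow, 1973). *)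
Inductive instr :=
| IConst (d k : nat)       (* r_d := k *)
| IAdd (d i j : nat)       (* r_d := r_i + r_j *)
| ISub (d i j : nat)       (* r_d := r_i - r_j, truncated *)
| IRead (d i : nat)        (* r_d := ram[r_i] *)
| IWrite (i j : nat)       (* ram[r_i] := r_j *)
| IJump (l : nat)          (* goto l *)
| IJumpZ (i l : nat).      (* if r_i = 0 then goto l *)

Definition program := seq instr.

Record config := Config { pc : nat; reg : nat -> nat; ram : nat -> nat }.

Definition upd (f : nat -> nat) (i v : nat) : nat -> nat :=
  fun j => if j == i then v else f j.

Definition exec_instr (ins : instr) (s : config) : config :=
  let: Config p r m := s in
  match ins with
  | IConst d k => Config p.+1 (upd r d k) m
  | IAdd d i j => Config p.+1 (upd r d (r i + r j)) m
  | ISub d i j => Config p.+1 (upd r d (r i - r j)) m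
  | IRead d i => Config p.+1 (upd r d (m (r i))) m
  | IWrite i j => Config p.+1 r (upd m (r i) (r j))
  | IJump l => Config l r m
  | IJumpZ i l => Config (if r i == 0 then l else p.+1) r m
  end.

(* The machine halts when the program counter leaves the program. *)
Definition halted (P : program) (s : config) : bool := size P <= pc s.

Definition step (P : program) (s : config) : config :=
  if onth P (pc s) is Some ins then exec_instr ins s else s.

(* The input word is stored in memory, one bit per cell from address 0 on, and
   its length in register 0; everything else is initially 0. *)
Definition init (w : seq bool) : config :=
  Config 0 (upd (fun=> 0) 0 (size w)) (fun i => nth false w i).

(* The machine accepts when register 0 is nonzero on halting. As a halted
   configuration is a fixed point of [step], the configuration reached after
   exactly [t] steps is final iff the machine halts within [t] steps. *)
Definition decides_within (P : program) (w : seq bool) (t : nat) (Q : Prop) :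
    Prop :=
  let s := iter t (step P) (init w) in
  halted P s /\ (reg s 0 != 0 <-> Q).

(* [encodes x w] means that the word [w] is an encoding of the instance [x];
   the machine must be correct on every encoding of every instance. *)
Definition polynomial_time (I : Type) (encodes : I -> seq bool -> Prop)
    (Q : I -> Prop) : Prop :=
  exists (P : program) (c k : nat),
    forall (x : I) (w : seq bool), encodes x w ->
      decides_within P w (c * size w ^ k + c) (Q x).

(* The number of vertices in unary, followed by the adjacency matrix row by
   row, with respect to an arbitrary ordering [s] of the vertices. *)
Definition graph_encoding (G : sgraph) (w : seq bool) : Prop :=
  exists s : seq G,
    [/\ uniq s, forall x : G, x \in s
      & w = nseq (size s) true ++ false :: [seq x -- y | x <- s, y <- s]].

(* Main.v *)
Require Import Defs.
From mathcomp Require Import all_boot zify.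

Set Implicit Arguments.
Unset Strict Implicit.
Unset Printing Implicit Defensive.

(* H is a triangle a, u, v with paths hanging from u and v. Pushing vertices of
   G along these paths towards the triangle turns any model of H into one whose
   branch sets, except those of a, u and v, are singletons. Once the singletons
   are guessed, the vertices left split into S, T and F: those that may only go
   to the branch set U of u, those that may only go to the branch set V of v,
   and those that may go to U, V or the branch set A of a; moreover U must meet
   S and V must meet T. If such sets exist, take A = {x0} and U as small as
   possible; for any x in U adjacent to x0, V may then be replaced by a whole
   component of T + F - {x0, x}, and U by the component of x in
   S + F - x0 - V. The minimality of U is what prevents the first component from
   hitting U. Hence containment of H is expressed by a fixed formula of
   first-order logic with a reachability operator, and such formulas are
   evaluated in polynomial time by structured programs compiled to the machine. *)

(** * Connected sets and models of induced minors *)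

(** The obstacle is that U and V compete for the vertices of F: two disjoint connected sets with
    prescribed contacts are not the answer to one reachability query, since choosing one set
    restricts the other. The roles are therefore made asymmetric: V is computed as if U were the
    single vertex x, and U is then computed in what is left. Sets found in this way form a model
    whenever they have the required contacts, minimal or not; minimality enters only in the
    converse. Pushing is possible because every vertex of H off the triangle has at most two
    neighbours. One vertex of G is guessed for each vertex of H off the triangle, and seven more; so
    the nesting of loops, and with it the exponent of the running time, depends on H alone. All
    loops run up to the input length, which the machine holds in a register from the start. *)

Lemma connect_ind (T : finType) (r : rel T) (P : pred T) x y :
  (forall z w, P z -> r z w -> P w) -> P x -> connect r x y -> P y.
Proof.
move=> Pr + /connectP[p rp ->]; elim: p x rp => //= z p IH x /andP[xz zp] Px.
by apply: IH => //; apply: Pr xz.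
Qed.

Section Connected.
Variable G : sgraph.
Implicit Types (A B D U : {set G}) (x y z : G).

Definition within D : rel G := [rel x y | [&& x -- y, x \in D & y \in D]].

Lemma withinE D x y : within D x y = [&& x -- y, x \in D & y \in D].
Proof. by []. Qed.

Definition connected D : Prop :=
  D != set0 /\ {in D &, forall x y, connect (within D) x y}.

Definition touch A B := [exists x in A, exists y in B, x -- y].

Definition component D x := [set y | connect (within D) x y].

Lemma touchP A B : reflect (exists x y, [/\ x \in A, y \in B & x -- y]) (touch A B).
Proof.
apply: (iffP exists_inP) => [[x xA /exists_inP[y yB xy]]|[x [y [xA yB xy]]]].
  by exists x, y.
by exists x => //; apply/exists_inP; exists y.
Qed.

Lemma touch_sym A B : touch A B = touch B A.
Proof.
by apply/touchP/touchP => -[x [y [xA yB xy]]]; exists y, x; split=> //;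
  rewrite sedge_sym.
Qed.

Lemma touchS A B A' B' : A \subset A' -> B \subset B' -> touch A B -> touch A' B'.
Proof.
move=> /subsetP AA /subsetP BB /touchP[x [y [xA yB xy]]].
by apply/touchP; exists x, y; rewrite AA ?BB.
Qed.

Lemma touch11 x y : touch [set x] [set y] = x -- y.
Proof.
apply/touchP/idP => [[x' [y' []]]|xy]; first by rewrite !inE => /eqP-> /eqP->.
by exists x, y; rewrite !inE.
Qed.

Lemma touchUl A B D : touch (A :|: B) D = touch A D || touch B D.
Proof.
apply/touchP/orP => [[x [y []]]|[]/touchP[x [y [xA yD xy]]]].
- by rewrite inE => /orP[] xA yD xy; [left|right]; apply/touchP; exists x, y.
- by exists x, y; rewrite inE xA.
- by exists x, y; rewrite inE xA orbT.
Qed.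

Lemma within_sym D : connect_sym (within D).
Proof.
apply: sym_connect_sym => x y; rewrite !withinE sedge_sym.
by rewrite [(y \in D) && _]andbC.
Qed.

Lemma connect_withinS A B x y :
  A \subset B -> connect (within A) x y -> connect (within B) x y.
Proof.
move=> /subsetP AB; apply: connect_sub => z w /and3P[zw zA wA].
by apply: connect1; rewrite withinE zw !AB.
Qed.

Lemma connected_root D x :
  x \in D -> {in D, forall y, connect (within D) x y} -> connected D.
Proof.
move=> xD h; split; first by apply/set0Pn; exists x.
by move=> y z yD zD; apply: connect_trans (h _ zD); rewrite within_sym; apply: h.
Qed.

Lemma connected1 x : connected [set x].
Proof. by apply: (@connected_root _ x); rewrite ?inE // => y; rewrite inE => /eqP->. Qed.

Lemma connectedU A B : connected A -> connected B -> touch A B -> connected (A :|: B).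
Proof.
move=> [_ cA] [_ cB] /touchP[x [y [xA yB xy]]].
apply: (@connected_root _ x); first by rewrite inE xA.
move=> z; rewrite inE => /orP[zA|zB].
  by apply: connect_withinS (cA _ _ xA zA); rewrite subsetUl.
apply: (@connect_trans _ _ y); last first.
  by apply: connect_withinS (cB _ _ yB zB); rewrite subsetUr.
by apply: connect1; rewrite withinE xy !inE xA yB orbT.
Qed.

Lemma connected_edge D x y :
  connected D -> x \in D -> y \in D -> x != y -> exists2 z, z \in D & x -- z.
Proof.
move=> [_ cD] xD yD xy; have [/exists_inP[z]|no] := boolP [exists z in D, x -- z].
  by exists z.
have : y == x; last by rewrite eq_sym (negPf xy).
apply: (@connect_ind _ _ (pred1 x) _ _ _ (eqxx x) (cD _ _ xD yD)) => z w /eqP-> /and3P[xw _ wD].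
by case/negP: no; apply/exists_inP; exists w.
Qed.

Lemma mem_component D x : x \in component D x.
Proof. by rewrite inE. Qed.

Lemma component_sub D x : x \in D -> component D x \subset D.
Proof.
move=> xD; apply/subsetP => y; rewrite inE.
by apply: (connect_ind (P := mem D)) => // z w _ /and3P[].
Qed.

Lemma component_closed D x y z :
  x \in D -> y \in component D x -> z \in D -> y -- z -> z \in component D x.
Proof.
move=> xD yC zD yz; have yD := subsetP (component_sub xD) _ yC.
by move: yC; rewrite !inE => yC; apply: connect_trans yC (connect1 _); rewrite withinE yz yD.
Qed.

Lemma component_connected D x : x \in D -> connected (component D x).
Proof.
move=> xD; apply: connected_root (mem_component D x) _ => y; rewrite {1}inE.
pose P z := connect (within (component D x)) x z && (z \in component D x).
move=> xy; suff /andP[] : P y by [].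
apply: (connect_ind _ _ xy) => [z w /andP[xz zC] /and3P[zw zD wD]|].
  have wC := component_closed xD zC wD zw; rewrite /P wC andbT.
  by apply: connect_trans xz (connect1 _); rewrite withinE zw zC.
by rewrite /P connect0 mem_component.
Qed.

Lemma component_max D V x :
  connected V -> V \subset D -> x \in V -> V \subset component D x.
Proof.
move=> [_ cV] VD xV; apply/subsetP => y yV; rewrite inE.
exact: connect_withinS VD (cV _ _ xV yV).
Qed.

(** Every component of [U :\ z] touches [z], for otherwise it would be closed under adjacency in
    [U], against the connectedness of [U]. Hence [z] holds together whatever is left once one
    component is removed. All exchange arguments below split a set at a vertex in this way. *)
Lemma connected_remove U z x : connected U -> z \in U -> x \in U -> x != z ->
  touch (component (U :\ z) x) [set z] /\ connected (U :\: component (U :\ z) x).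
Proof.
move=> [_ cU] zU xU xz.
have tz y : y \in U -> y != z -> touch (component (U :\ z) y) [set z].
  move=> yU yz; have yUz : y \in U :\ z by rewrite !inE yz.
  have [//|no] := boolP (touch (component (U :\ z) y) [set z]).
  suff : z \in component (U :\ z) y.
    by move/(subsetP (component_sub yUz)); rewrite !inE eqxx.
  apply: (connect_ind (P := mem (component (U :\ z) y)) _ _ (cU _ _ yU zU)).
    move=> u w uC /and3P[uw uU wU]; have [wz|wz] := eqVneq w z.
      by case/negP: no; apply/touchP; exists u, w; split=> //; rewrite wz set11.
    by apply: component_closed uC _ uw; rewrite // !inE wz.
  exact: mem_component.
have xUz : x \in U :\ z by rewrite !inE xz.
split; first exact: tz.
apply: (@connected_root _ z) => [|y].
  rewrite inE zU andbT; apply/negP => /(subsetP (component_sub xUz)).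
  by rewrite !inE eqxx.
rewrite inE => /andP[yD yU]; have [->|yz] := eqVneq y z; first exact: connect0.
have yUz : y \in U :\ z by rewrite !inE yz.
have sub : component (U :\ z) y \subset U :\: component (U :\ z) x.
  apply/subsetP => w wC; have := subsetP (component_sub yUz) _ wC.
  rewrite !inE => /andP[_ ->]; rewrite andbT; apply: contra yD => xw.
  rewrite inE; apply: connect_trans xw _; rewrite within_sym.
  by move: wC; rewrite inE.
have /touchP[w [z' [wC /set1P-> wz]]] := tz _ yU yz.
have zD : z \in U :\: component (U :\ z) x.
  rewrite inE zU andbT; apply/negP => /(subsetP (component_sub xUz)).
  by rewrite !inE eqxx.
apply: (@connect_trans _ _ w).
  by apply: connect1; rewrite withinE sedge_sym wz zD (subsetP sub).
apply: connect_withinS sub _.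
by apply: (proj2 (component_connected yUz)) => //; apply: mem_component.
Qed.

End Connected.

(** Vertices of [G] in no branch set are the deleted ones. The equality with [touch], rather than an
    implication, makes the minor induced; it excludes [h = k] because a branch set with an inner
    edge touches itself. *)
Definition minor_model (H G : sgraph) (B : H -> {set G}) : Prop :=
  [/\ forall h, connected (B h),
      forall h k x, x \in B h -> x \in B k -> h = k
    & forall h k, h != k -> h -- k = touch (B h) (B k)].

(** A single deletion or contraction gives a model of the smaller graph in the larger one, so
    composition carries the induction along a sequence of such operations. *)
Lemma minor_model_comp (H G G' : sgraph) (C : G' -> {set G}) (B : H -> {set G'}) :
  minor_model C -> minor_model B ->
  minor_model (fun h => \bigcup_(g in B h) C g).
Proof.
move=> [cC dC tC] [cB dB tB]; split=> [h|h k x|h k hk].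
- have [/set0Pn[g0 g0B] cB'] := cB h.
  have [/set0Pn[x0 x0C] cC0] := cC g0.
  have sub g : g \in B h -> C g \subset \bigcup_(g in B h) C g.
    by move=> gB; apply: bigcup_sup.
  have reach g : g \in B h -> [forall x in C g, connect (within (\bigcup_(g in B h) C g)) x0 x].
    move=> gB; pose P g := (g \in B h) &&
      [forall x in C g, connect (within (\bigcup_(g in B h) C g)) x0 x].
    suff /andP[] : P g by [].
    apply: (connect_ind _ _ (cB' _ _ g0B gB)) => [g1 g2 /andP[g1B h1] /and3P[g12 _ g2B]|].
      rewrite /P g2B; apply/forall_inP => x xC.
      have : touch (C g1) (C g2) by rewrite -tC //; apply: contraTneq g12 => ->; rewrite sedge_irr.
      case/touchP=> y [z [yC zC yz]].
      apply: connect_trans (forall_inP h1 _ yC) _.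
      apply: (@connect_trans _ _ z).
        by apply: connect1; rewrite withinE yz (subsetP (sub _ g1B)) ?(subsetP (sub _ g2B)).
      exact: connect_withinS (sub _ g2B) (proj2 (cC g2) _ _ zC xC).
    rewrite /P g0B; apply/forall_inP => x xC.
    exact: connect_withinS (sub _ g0B) (cC0 _ _ x0C xC).
  apply: (@connected_root _ _ x0); first exact: (subsetP (sub _ g0B)).
  by move=> x /bigcupP[g gB xC]; exact: (forall_inP (reach _ gB)).
- move=> /bigcupP[g gB xg] /bigcupP[g' g'B xg'].
  by apply: dB gB _; rewrite (dC _ _ _ xg xg').
- rewrite tB //; apply/touchP/touchP.
    move=> [g [g' [gB g'B gg']]].
    have : touch (C g) (C g') by rewrite -tC //; apply: contraTneq gg' => ->; rewrite sedge_irr.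
    case/touchP=> y [z [yC zC yz]]; exists y, z; split=> //.
      by apply/bigcupP; exists g.
    by apply/bigcupP; exists g'.
  move=> [x [y [/bigcupP[g gB xg] /bigcupP[g' g'B yg'] xy]]].
  exists g, g'; split=> //; rewrite tC; first by apply/touchP; exists x, y.
  by apply: contraNneq hk => e; apply/eqP/(dB _ _ _ gB); rewrite e.
Qed.

Lemma minor_model_of_minor (H G : sgraph) :
  induced_minor H G -> exists B : H -> {set G}, minor_model B.
Proof.
elim=> {G} [G [f [g fK gK] fe]|G x _ [B mB]|G x y xy _ [B mB]].
- exists (fun h => [set g h]); split=> [h|h k x|h k _].
  + exact: connected1.
  + by rewrite !inE => /eqP-> /eqP/(can_inj gK).
  + by rewrite touch11 -fe !gK.
- exists (fun h => \bigcup_(z in B h) [set val z]); apply: minor_model_comp mB.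
  split=> [h|h k z|h k _].
  + exact: connected1.
  + by rewrite !inE => /eqP-> /eqP/val_inj.
  + by rewrite touch11.
- pose C (z : contract_edge x y) := val z |: [set v | (val z == x) && (v == y)].
  have CE v z : (v \in C z) = (v == val z) || ((val z == x) && (v == y)) by rewrite !inE.
  have yN (z : contract_edge x y) : (y == val z) = false.
    by case: z => v vy; apply: negbTE; rewrite eq_sym.
  exists (fun h => \bigcup_(z in B h) C z); apply: minor_model_comp mB.
  split=> [z|z z' v|z z' zz'].
  + apply: (@connected_root _ _ (val z)); first by rewrite CE eqxx.
    move=> v; rewrite CE => /orP[/eqP->|/andP[/eqP zx /eqP->]]; first exact: connect0.
    by apply: connect1; rewrite withinE !CE zx xy !eqxx orbT.
  + rewrite !CE => /orP[/eqP->|/andP[/eqP zx /eqP->]] /orP[/eqP e|/andP[/eqP z'x /eqP e]].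
    * exact: val_inj.
    * by have := yN z; rewrite e eqxx.
    * by have := yN z'; rewrite -e eqxx.
    * by apply: val_inj; rewrite zx.
  + rewrite (_ : (z -- z') = @contract_edge_edge G x y z z') // /contract_edge_edge zz' andTb.
    apply/or3P/touchP => [[e|/andP[/eqP zx e]|/andP[/eqP z'x e]]|].
    * by exists (val z), (val z'); rewrite !CE !eqxx.
    * by exists y, (val z'); rewrite !CE zx !eqxx orbT.
    * by exists (val z), y; rewrite !CE z'x !eqxx orbT sedge_sym.
    * move=> [v [w []]]; rewrite !CE.
      case/orP=> [/eqP->|/andP[zx /eqP->]] /orP[/eqP->|/andP[z'x /eqP->]] e.
      - by constructor 1.
      - by constructor 3; rewrite z'x sedge_sym.
      - by constructor 2; rewrite zx.
      - by move: e; rewrite sedge_irr.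
Qed.

Lemma connected_imset (G G' : sgraph) (r : G -> G') (D : {set G}) :
  {in D &, forall v w, v -- w -> r v != r w -> r v -- r w} ->
  connected D -> connected (r @: D).
Proof.
move=> hr [/set0Pn[x xD] cD]; apply: (@connected_root _ _ (r x)); first exact: imset_f.
move=> _ /imsetP[y yD ->].
pose P v := (v \in D) && connect (within (r @: D)) (r x) (r v).
suff /andP[] : P y by [].
apply: (connect_ind _ _ (cD _ _ xD yD)) => [v w /andP[vD xv] /and3P[vw _ wD]|].
  rewrite /P wD; have [<- //|vw'] := eqVneq (r v) (r w).
  apply: connect_trans xv (connect1 _).
  by rewrite withinE hr ?imset_f.
by rewrite /P xD connect0.
Qed.

(** Deletion and contraction both act on branch sets as the image under a map [r]. For deletion [r]
    is meaningful only away from the deleted vertex, so the hypotheses on [r] are confined to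
    vertices of branch sets. *)
Lemma minor_model_imset (H G G' : sgraph) (r : G -> G') (B : H -> {set G}) :
  minor_model B ->
  (forall h k v w, v \in B h -> w \in B k -> r v = r w -> h = k) ->
  (forall h k v w, v \in B h -> w \in B k -> v -- w -> r v != r w -> r v -- r w) ->
  (forall h k v w, v \in B h -> w \in B k -> h != k -> r v -- r w -> touch (B h) (B k)) ->
  minor_model (fun h => r @: B h).
Proof.
move=> [cB dB tB] inj_r hom_r touch_r; split=> [h|h k x|h k hk].
- apply: connected_imset (cB h) => v w; exact: hom_r.
- by case/imsetP=> v vB ->; case/imsetP=> w wB; apply: inj_r.
- rewrite tB //; apply/idP/touchP => [/touchP[v [w [vB wB vw]]]|[x [y [/imsetP[v vB ->]]]]].
    exists (r v), (r w); rewrite !imset_f //; split=> //.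
    by apply: (hom_r h k) => //; apply: contraNneq hk => /(inj_r _ _ _ _ vB wB)->.
  by case/imsetP=> w wB ->; apply: touch_r.
Qed.

(** Induction on the size of [G]: a vertex outside the branch sets is deleted, an edge inside a
    branch set is contracted. When neither exists, the branch sets are singletons that cover [G],
    and the model is an isomorphism. *)
Lemma minor_of_minor_model (H G : sgraph) (h0 : H) (B : H -> {set G}) :
  minor_model B -> induced_minor H G.
Proof.
have [n] := ubnP #|G|; elim: n G B => // n IH G B /ltnSE leGn mB.
have [cB dB tB] := mB.
have card_del (y : G) : #|{: {z : G | z != y}}| < n.
  rewrite card_sig; apply: leq_trans leGn.
  by rewrite (cardD1 y G) inE ltnS; apply/eq_leq/eq_card => z; rewrite !inE andbT.
have [/forallP cover|/forallPn[x /existsPn Nx]] := boolP [forall x, exists h, x \in B h]; last first.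
  (* The branch set of [h0] supplies a vertex that survives the deletion. It is the default value of
     [r], taken only at [x], which lies in no branch set. *)
  have [z0 z0x] : exists z0, z0 != x.
    have [/set0Pn[z0 z0B] _] := cB h0; exists z0.
    by apply: contraTneq z0B => ->.
  pose r v : del_vertex x := insubd (exist _ z0 z0x : {z | z != x}) v.
  have rE h v : v \in B h -> val (r v) = v.
    by move=> vB; rewrite val_insubd ifT //; apply: contraTneq vB => ->.
  apply: (induced_minor_del (x := x)).
  apply: (IH (del_vertex x) (fun h => r @: B h) (card_del x)).
  apply: (minor_model_imset mB) => h k v w vB wB.
  - by move/(congr1 val); rewrite (rE _ _ vB) (rE _ _ wB) => e; apply: dB vB _; rewrite e.
  - by move=> vw _; rewrite /sedge /= /del_vertex_edge (rE _ _ vB) (rE _ _ wB).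
  - rewrite /sedge /= /del_vertex_edge (rE _ _ vB) (rE _ _ wB) => _ vw.
    by apply/touchP; exists v, w.
have [/existsP[h /existsP[x /existsP[x' /and3P[xB x'B xx']]]]|single] :=
  boolP [exists h, exists x, exists x', [&& x \in B h, x' \in B h & x != x']].
  have [y yB xy] := connected_edge (cB h) xB x'B xx'.
  have xNy : x != y by apply: contraTneq xy => ->; rewrite sedge_irr.
  pose r v : contract_edge x y := insubd (exist _ x xNy : {z | z != y}) v.
  have rE v : val (r v) = if v == y then x else v.
    by rewrite val_insubd /=; case: eqP.
  have rB k v : (val (r v) \in B k) = (v \in B k).
    rewrite rE; case: eqP => // ->; apply/idP/idP => [/(dB _ _ _ xB)<-//|/(dB _ _ _ yB)<-//].
  have eE (z z' : contract_edge x y) : (z -- z') =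
      (z != z') && [|| val z -- val z', (val z == x) && (y -- val z')
                           | (val z' == x) && (y -- val z)] by [].
  apply: (induced_minor_contract xy).
  apply: (IH (contract_edge x y) (fun h => r @: B h) (card_del y)).
  apply: (minor_model_imset mB) => k k' v w vB wB.
  - move/(congr1 val) => e; apply: (dB _ _ (val (r v))); first by rewrite rB.
    by rewrite e rB.
  - move=> vw vNw; rewrite eE vNw /= !rE; move: vNw; rewrite -val_eqE !rE.
    case: (eqVneq v y) vw => [->|vy]; case: (eqVneq w y) => [->|wy] //.
    + by rewrite eqxx.
    + by rewrite eqxx => ->; rewrite orbT.
    + by rewrite eqxx sedge_sym => ->; rewrite !orbT.
    + by move=> ->.
  - move=> kk'; rewrite eE => /andP[_ /or3P[e|/andP[/eqP zx e]|/andP[/eqP zx e]]];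
      apply/touchP.
    + by exists (val (r v)), (val (r w)); rewrite !rB.
    + exists y, (val (r w)); rewrite rB; split=> //.
      by have := vB; rewrite -rB zx => /(dB _ _ _ xB)<-.
    + exists (val (r v)), y; rewrite rB sedge_sym; split=> //.
      by have := wB; rewrite -rB zx => /(dB _ _ _ xB)<-.
have inj h x y : x \in B h -> y \in B h -> x = y.
  move=> xB yB; apply/eqP; apply: contraNT single => xy.
  by apply/existsP; exists h; apply/existsP; exists x; apply/existsP; exists y; rewrite xB yB.
have neB h : exists x, x \in B h by apply/set0Pn; case: (cB h).
pose f x := xchoose (existsP (cover x)); pose g h := xchoose (neB h).
have fB x : x \in B (f x) := xchooseP (existsP (cover x)).
have gB h : g h \in B h := xchooseP (neB h).
apply: induced_minor_iso; exists f.
  by exists g => [x|h]; [apply: inj (gB _) (fB _) | apply: dB (fB _) (gB _)].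
move=> x y; have [->|xy] := eqVneq x y; first by rewrite !sedge_irr.
have fxy : f x != f y by apply: contraNneq xy => e; apply/eqP/(inj (f x)) => //; rewrite e.
rewrite tB //; apply/touchP/idP => [[x' [y' [xB yB]]]|xy']; last by exists x, y.
by rewrite (inj _ _ _ xB (fB x)) (inj _ _ _ yB (fB y)).
Qed.

(* Moving a vertex of B h to B p lowers the sum of the wt h * #|B h|. *)
Lemma minor_model_singletons (H G : sgraph) (core : pred H) (wt : H -> nat)
    (B : H -> {set G}) :
  (forall h, ~~ core h -> exists p k,
     [/\ wt p < wt h, h -- p & forall l, h -- l -> l = p \/ l = k]) ->
  minor_model B ->
  exists2 B' : H -> {set G}, minor_model B' & forall h, ~~ core h -> exists x, B' h = [set x].
Proof.
move=> hH; have [n] := ubnP (\sum_h wt h * #|B h|).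
elim: n B => // n IH B /ltnSE wB mB; have [cB dB tB] := mB.
have [/forall_inP all1|] := boolP [forall (h | ~~ core h), #|B h| == 1].
  by exists B => // h /all1 /cards1P.
case/forall_inPn=> h hc Bh1.
have [p [k [wp hp hk]]] := hH h hc.
have hNp : h != p by apply: contraTneq wp => ->; rewrite ltnn.
have Bh2 : 1 < #|B h|.
  by rewrite ltn_neqAle eq_sym Bh1 card_gt0; case: (cB h).
have : touch (B h) (B p) by rewrite -tB.
case/touchP=> y [y' [yB y'B yy']].
have sub1 : [set y] \subset B h by rewrite sub1set.
(* If [y], which touches [B p], also provides the edge to [k] when there is one, then [y] alone can
   replace [B h]. Otherwise [y] is moved to [B p]. *)
have [ok|bad] := boolP ((h -- k) ==> touch [set y] (B k)).
  pose B' l := if l == h then [set y] else B l.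
  have B'h : B' h = [set y] by rewrite /B' eqxx.
  have B'l l : l != h -> B' l = B l by rewrite /B' => /negPf->.
  have subB' l : B' l \subset B l by rewrite /B'; case: eqP => // ->.
  apply: (IH B'); last split.
  - apply: leq_trans wB; rewrite [X in _ < X](bigD1 h) //= (bigD1 h) //= B'h cards1 muln1.
    rewrite (eq_bigr (fun l => wt l * #|B l|)) => [|l /B'l-> //].
    by rewrite ltn_add2r -{1}(muln1 (wt h)) ltn_pmul2l // (leq_ltn_trans _ wp).
  - by move=> l; rewrite /B'; case: eqP => // _; apply: connected1.
  - move=> l l' x /(subsetP (subB' _)) xl /(subsetP (subB' _)); exact: dB xl.
  - have th l : l != h -> h -- l = touch [set y] (B l).
      move=> lh; apply/idP/idP => [hl|]; last first.
        by move/(touchS sub1 (subxx _)); rewrite -tB // eq_sym.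
      case: (hk l hl) => ?; subst l; last exact: (implyP ok).
      by apply/touchP; exists y, y'; rewrite set11.
    move=> l l' ll'; have [?|lh] := eqVneq l h; [subst l|].
      by rewrite B'h B'l ?th // eq_sym.
    have [?|l'h] := eqVneq l' h; [subst l'|by rewrite !B'l ?tB].
    by rewrite B'h B'l // sedge_sym th // touch_sym.
move: bad; rewrite negb_imply => /andP[hk' yk].
have hNk : h != k by apply: contraTneq hk' => ->; rewrite sedge_irr.
have pNk : p != k.
  by apply: contraNneq yk => <-; apply/touchP; exists y, y'; rewrite set11.
have : touch (B h) (B k) by rewrite -tB.
case/touchP=> w [w' [wBh w'B ww']].
have wy : w != y.
  by apply: contraNneq yk => <-; apply/touchP; exists w, w'; rewrite set11.
(* Once [y] has left, [B h] is cut down to the part [D] that contains a contact [w] with [B k]. As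
   [D] touches [y], the edge from [h] to [p] survives; the other parts of [B h] are dropped. *)
have [tD _] := connected_remove (cB h) yB wBh wy.
set D := component (B h :\ y) w in tD.
have wDy : w \in B h :\ y by rewrite !inE wy.
have DB : D \subset B h :\ y by apply: component_sub.
have DBh : D \subset B h by apply: subset_trans DB (subsetDl _ _).
have yND : y \notin D by apply/negP => /(subsetP DB); rewrite !inE eqxx.
have yNp : y \notin B p by apply: contra hNp => yp; apply/eqP; apply: dB yB yp.
pose B' l := if l == h then D else if l == p then y |: B p else B l.
have pNh : p != h by rewrite eq_sym.
have B'h : B' h = D by rewrite /B' eqxx.
have B'p : B' p = y |: B p by rewrite /B' (negPf pNh) eqxx.
have B'l l : l != h -> l != p -> B' l = B l by rewrite /B' => /negPf-> /negPf->.
apply: (IH B'); last split.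
- apply: leq_trans wB; rewrite [X in _ < X](bigD1 h) //= (bigD1 h) //= B'h.
  rewrite [X in _ < _ + X](bigD1 p) //= (bigD1 p) //= B'p.
  rewrite (eq_bigr (fun l => wt l * #|B l|)) => [|l /andP[h1 h2]]; last by rewrite B'l.
  rewrite cardsU1 yNp (cardsD1 y (B h)) yB !addnA ltn_add2r.
  have := leq_mul (leqnn (wt h)) (subset_leq_card DB).
  rewrite !mulnDr !muln1 addnA [wt h + _]addnC -addnA => le_card.
  by rewrite addnA ltn_add2r -addnS leq_add.
- move=> l; have [->|lh] := eqVneq l h; first by rewrite B'h; apply: component_connected.
  have [->|lp] := eqVneq l p; last by rewrite B'l.
  rewrite B'p; apply: connectedU => //; first exact: connected1.
  by apply/touchP; exists y, y'; rewrite set11.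
- have B'B l x : x \in B' l -> x \in B l /\ (x != y \/ l = h) \/ l = p /\ x = y.
    have [->|lh] := eqVneq l h; first by rewrite B'h => /(subsetP DBh); left; split=> //; right.
    have [->|lp] := eqVneq l p; last first.
      rewrite B'l // => xl; left; split=> //; left; apply: contraNneq lh => e.
      by apply/eqP; apply: dB xl _; rewrite e.
    rewrite B'p => /setU1P[->|xp]; first by right.
    by left; split=> //; left; apply: contraNneq yNp => <-.
  move=> l l' x xl xl'; case: (B'B _ _ xl) => [[xBl c]|[? ?]]; case: (B'B _ _ xl') => [[xBl' c']|[? ?]];
    subst=> //; first exact: dB xBl xBl'.
    case: c => [|?]; first by rewrite eqxx.
    by subst l; move: xl; rewrite B'h (negPf yND).
  case: c' => [|?]; first by rewrite eqxx.
  by subst l'; move: xl'; rewrite B'h (negPf yND).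
- have thl l : l != h -> l != p -> h -- l = touch D (B l).
    move=> lh lp; apply/idP/idP => [hl|]; last first.
      by move/(touchS DBh (subxx _)); rewrite -tB // eq_sym.
    case: (hk l hl) => ?; subst l; first by rewrite eqxx in lp.
    by apply/touchP; exists w, w'; rewrite mem_component.
  (* As a former vertex of [B h], [y] touches only branch sets of neighbours of [h], and it misses
     [B k]. So [B p] gains no new neighbour by receiving [y]. *)
  have tpl l : l != h -> l != p -> p -- l = touch (y |: B p) (B l).
    move=> lh lp; rewrite touchUl -tB 1?eq_sym //; case: (boolP (touch [set y] _)) => // t.
    have hl : h -- l by rewrite tB 1?eq_sym //; apply: touchS t.
    case: (hk l hl) => ?; subst l; first by rewrite eqxx in lp.
    by rewrite t in yk.
  have thp : touch D (y |: B p).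
    by rewrite touch_sym touchUl touch_sym tD.
  move=> l l' ll'.
  have [?|lh] := eqVneq l h; [subst l|].
    rewrite B'h; have [?|lp] := eqVneq l' p; [subst l'|].
      by rewrite B'p thp hp.
    by rewrite B'l ?thl // eq_sym.
  have [?|l'h] := eqVneq l' h; [subst l'|].
    rewrite B'h sedge_sym touch_sym; have [?|lp] := eqVneq l p; [subst l|].
      by rewrite B'p thp hp.
    by rewrite B'l ?thl.
  have [?|lp] := eqVneq l p; [subst l|].
    by rewrite B'p B'l ?tpl // eq_sym.
  have [?|l'p] := eqVneq l' p; [subst l'|].
    by rewrite B'p B'l // sedge_sym touch_sym tpl.
  by rewrite !B'l ?tB.
Qed.

(** * The branch sets of the triangle *)

Section Linkage.
Variables (G : sgraph) (S T F : {set G}).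
Hypotheses (ST : [disjoint S & T]) (TF : [disjoint T & F]).

(** Here [H] is out of sight. Later [S] and [T] consist of the vertices whose only neighbour among
    the guessed singletons is the image of [b], respectively [c], so that meeting them produces the
    edges [ub] and [vc]. *)
Record linkage (U V A : {set G}) : Prop := Linkage {
  lk_connU : connected U;
  lk_connV : connected V;
  lk_connA : connected A;
  lk_subU : U \subset S :|: F;
  lk_subV : V \subset T :|: F;
  lk_subA : A \subset F;
  lk_disjUV : [disjoint U & V];
  lk_disjUA : [disjoint U & A];
  lk_disjVA : [disjoint V & A];
  lk_meetS : exists2 s, s \in U & s \in S;
  lk_meetT : exists2 t, t \in V & t \in T;
  lk_touchUV : touch U V;
  lk_touchUA : touch U A;
  lk_touchVA : touch V A }.

(** The vertex [x] is removed by hand: it is the contact of [U] with [a], must stay in [U], and may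
    well be adjacent to the far side. As the near side is taken outside the far side, their
    disjointness is built in. *)
Definition far_side a x t := component ((T :|: F) :\: [set a; x]) t.
Definition near_side a x t := component ((S :|: F) :\: (a |: far_side a x t)) x.

(** Only memberships, adjacencies and reachability occur, and no minimality. The first group of
    conditions also ensures that [t] and [x] belong to the sets whose components they generate. *)
Definition certificate a x t s v u1 v1 :=
  [&& [&& a \in F, x \in S :|: F, t \in T, s \in S & a -- x],
      [&& s \in near_side a x t, v \in far_side a x t & a -- v]
    & [&& u1 \in near_side a x t, v1 \in far_side a x t & u1 -- v1]].

Lemma disjointP (A B : {set G}) :
  reflect (forall x, x \in A -> x \in B -> False) [disjoint A & B].
Proof.
apply: (iffP idP) => [/disjoint_setI0 d x xA xB|d].
  by have := in_set0 x; rewrite -d inE xA xB.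
rewrite -setI_eq0; apply/eqP/setP => x; rewrite !inE; apply/andP => -[]; exact: d.
Qed.

Lemma mem_far_side_domain a x t : a \in F -> x \in S :|: F -> t \in T ->
  t \in (T :|: F) :\: [set a; x].
Proof.
move=> aF xSF tT; rewrite in_setD in_set2 in_setU tT andbT; apply/norP; split.
  by apply: contraL tT => /eqP->; apply/negP => aT; apply: (disjointP _ _ TF) aT aF.
apply: contraL tT => /eqP->; apply/negP => xT.
by case/setUP: xSF => [xS|xF]; [apply: (disjointP _ _ ST) xS xT|apply: (disjointP _ _ TF) xT xF].
Qed.

Lemma certificate_linkage a x t s v u1 v1 :
  certificate a x t s v u1 v1 -> linkage (near_side a x t) (far_side a x t) [set a].
Proof.
case/and3P=> /and5P[aF xSF tT sS ax] /and3P[sN vV av] /and3P[uN v1V uv].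
have tD := mem_far_side_domain aF xSF tT.
have sub : far_side a x t \subset (T :|: F) :\: [set a; x] := component_sub tD.
have xNa : x != a by apply: contraTneq ax => ->; rewrite sedge_irr.
have xD : x \in (S :|: F) :\: (a |: far_side a x t).
  rewrite in_setD xSF andbT in_setU1 negb_or xNa.
  by apply/negP => /(subsetP sub); rewrite !inE eqxx orbT.
have subN : near_side a x t \subset (S :|: F) :\: (a |: far_side a x t) := component_sub xD.
split.
- exact: component_connected.
- exact: component_connected.
- exact: connected1.
- exact: subset_trans subN (subsetDl _ _).
- exact: subset_trans sub (subsetDl _ _).
- by rewrite sub1set.
- apply/disjointP => y /(subsetP subN); rewrite in_setD in_setU1.
  by case/andP => /norP[_ /negP].
- apply/disjointP => y /(subsetP subN); rewrite in_setD in_setU1 in_set1.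
  by case/andP => /norP[/negP].
- by apply/disjointP => y /(subsetP sub); rewrite !inE => /andP[/norP[/negP]].
- by exists s.
- by exists t => //; apply: mem_component.
- by apply/touchP; exists u1, v1.
- by apply/touchP; exists x, a; rewrite set11 sedge_sym; split=> //; apply: mem_component.
- by apply/touchP; exists v, a; rewrite set11 sedge_sym.
Qed.

(** Keep a vertex [a] of [A] that touches [U]. If it misses [V], the component of [A :\ a] through
    which [A] reaches [V] is handed over to [V], which is allowed because [A] lies in [F]. The gain
    goes to [V] and not to [U], so an induction on the size of [U] is undisturbed. *)
Lemma linkage_singleton U V A :
  linkage U V A -> exists a V', linkage U V' [set a].
Proof.
case=> cU cV cA sU sV sA dUV dUA dVA mS mT tUV tUA tVA.
have /touchP[x [a [xU aA xa]]] := tUA.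
have aF : [set a] \subset F by rewrite sub1set (subsetP sA).
have aNU : [disjoint U & [set a]].
  by apply/disjointP => y yU /set1P e; subst y; apply: (disjointP _ _ dUA) yU aA.
have aNV : [disjoint V & [set a]].
  by apply/disjointP => y yV /set1P e; subst y; apply: (disjointP _ _ dVA) yV aA.
have tUa : touch U [set a] by apply/touchP; exists x, a; rewrite set11.
exists a; have [tVa|tVa] := boolP (touch V [set a]).
  by exists V; split=> //; apply: connected1.
have /touchP[y [c [yV cA' yc]]] := tVA.
have ca : c != a.
  by apply: contraNneq tVa => ca; apply/touchP; exists y, a; rewrite set11 -ca.
have [tC _] := connected_remove cA aA cA' ca.
set C := component _ c in tC.
have cAa : c \in A :\ a by rewrite !inE ca.
have sC : C \subset A :\ a := component_sub cAa.
have cC : c \in C := mem_component _ _.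
exists (V :|: C); split=> //.
- apply: connectedU cV _ _; first exact: component_connected.
  by apply/touchP; exists y, c.
- exact: connected1.
- rewrite subUset sV (subset_trans sC) // (subset_trans (subsetDl _ _)) //.
  by rewrite (subset_trans sA) // subsetUr.
- apply/disjointP => z zU /setUP[zV|/(subsetP sC)]; first exact: (disjointP _ _ dUV) zU zV.
  by rewrite !inE => /andP[_]; apply: (disjointP _ _ dUA) zU.
- apply/disjointP => z /setUP[zV|/(subsetP sC)]; first exact: (disjointP _ _ aNV) zV.
  by rewrite !inE => /andP[/negP].
- by case: mT => t tV tT; exists t; rewrite ?inE ?tV.
- by apply: touchS tUV; rewrite ?subsetUl.
- by rewrite touchUl tC orbT.
Qed.

(** The induction on [#|U|] ranges over all linkages, with [A] of any size, because one of the two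
    exchanges enlarges [A]; each round first shrinks [A] back to a vertex. *)
Lemma linkage_certificate U V A :
  linkage U V A -> exists a x t s v u1 v1, certificate a x t s v u1 v1.
Proof.
have [n] := ubnP #|U|; elim: n U V A => // n IH U V0 A0 /ltnSE leUn.
case/linkage_singleton=> a [V [cU cV cA sU sV sA dUV dUA dVA [s sU' sS] [t tV tT] tUV tUA tVA]].
have smaller U' V' A' : linkage U' V' A' -> #|U'| < #|U| ->
    exists a x t s v u1 v1, certificate a x t s v u1 v1.
  by move=> lk lt; apply: IH lk; apply: leq_trans lt leUn.
have /touchP[x [a' [xU /set1P-> xa]]] := tUA.
have /touchP[v [a'' [vV /set1P-> va]]] := tVA.
have /touchP[u1 [v1 [u1U v1V uv]]] := tUV.
have aF : a \in F by rewrite -sub1set.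
have aNU : a \notin U by apply/negP => aU; apply: (disjointP _ _ dUA) aU (set11 a).
have aNV : a \notin V by apply/negP => aV; apply: (disjointP _ _ dVA) aV (set11 a).
have UV y : y \in U -> y \in V -> False by apply/disjointP.
have sVD : V \subset (T :|: F) :\: (a |: U).
  apply/subsetP => y yV; rewrite in_setD (subsetP sV) // andbT in_setU1.
  apply/norP; split; first by apply: contraNneq aNV => <-.
  by apply/negP => /UV; apply.
have tD := subsetP sVD _ tV.
(* [W] is the largest choice of [V] for the given [a] and [U]. The far side forbids only [x] instead
   of all of [U]; the two agree as soon as [W] touches no vertex of [U] in [F] other than [x]. *)
pose W := component ((T :|: F) :\: (a |: U)) t.
have VW : V \subset W by apply: component_max.
have sW : W \subset (T :|: F) :\: (a |: U) by apply: component_sub.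
have cW : connected W by apply: component_connected.
have tW : t \in W := mem_component _ _.
have WN y : y \in W -> y != a /\ y \notin U.
  by move/(subsetP sW); rewrite in_setD in_setU1 => /andP[/norP[]].
have tWa : touch W [set a] by apply: touchS tVA.
have [/exists_inP[y yW /exists_inP[z zU /andP[yz /andP[zF zx]]]]|closed] :=
    boolP [exists y in W, exists z in U, y -- z && ((z \in F) && (z != x))].
  (* V reaches another vertex z of U: if the part D of U - z containing x meets
     S, it can replace U (z going to V); otherwise D can go to A. *)
  have xz : x != z by rewrite eq_sym.
  have [tDz cUD] := connected_remove cU zU xU xz.
  set D := component (U :\ z) x in tDz cUD.
  have xUz : x \in U :\ z by rewrite !inE xz.
  have sD : D \subset U :\ z := component_sub xUz.
  have xD : x \in D := mem_component _ _.
  have DU y' : y' \in D -> y' \in U /\ y' != z.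
    by move/(subsetP sD); rewrite !inE => /andP[].
  have zND : z \notin D by apply/negP => /DU[_]; rewrite eqxx.
  have DUs : D \subset U by apply: subset_trans sD (subsetDl _ _).
  have za : z != a by apply: contraNneq aNU => <-.
  have [/exists_inP[s' s'D s'S]|noS] := boolP [exists s' in D, s' \in S].
    apply: (smaller D (z |: W) [set a]); last first.
      by rewrite proper_card // properE DUs; apply/subsetPn; exists z.
    split=> //.
    - exact: component_connected.
    - apply: connectedU => //; first exact: connected1.
      by apply/touchP; exists z, y; rewrite set11 sedge_sym.
    - exact: subset_trans DUs sU.
    - by rewrite subUset sub1set in_setU zF orbT (subset_trans sW) // subsetDl.
    - apply/disjointP => y' /DU[y'U y'z] /setU1P[e|/WN[_ /negP//]].
      by rewrite e eqxx in y'z.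
    - by apply/disjointP => y' /DU[y'U _] /set1P e; rewrite -e y'U in aNU.
    - apply/disjointP => y' /setU1P[->|/WN[y'a _]] /set1P e.
        by rewrite e eqxx in za.
      by rewrite e eqxx in y'a.
    - by exists s'.
    - by exists t => //; rewrite in_setU tW orbT.
    - by apply: touchS tDz; rewrite // subsetUl.
    - by apply/touchP; exists x, a; rewrite set11.
    - by rewrite touchUl tWa orbT.
  apply: (smaller (U :\: D) W (a |: D)); last first.
    rewrite proper_card // properE subsetDl; apply/subsetPn; exists x => //.
    by rewrite in_setD xD.
  split=> //.
  - apply: connectedU; [exact: connected1|exact: component_connected|].
    by apply/touchP; exists a, x; rewrite set11 sedge_sym.
  - exact: subset_trans (subsetDl _ _) sU.
  - exact: subset_trans sW (subsetDl _ _).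
  - apply/subsetP => y' /setU1P[-> //|y'D].
    have [y'U _] := DU _ y'D; case/setUP: (subsetP sU _ y'U) => // y'S.
    by case/negP: noS; apply/exists_inP; exists y'.
  - by apply/disjointP => y' /setDP[y'U _] /WN[_ /negP].
  - apply/disjointP => y' /setDP[y'U y'D] /setU1P[e|]; last exact/negP.
    by rewrite -e y'U in aNU.
  - apply/disjointP => y' /WN[y'a y'U] /setU1P[e|/DU[]]; last by rewrite (negPf y'U).
    by rewrite e eqxx in y'a.
  - exists s => //; rewrite in_setD sU' andbT; apply: contra noS => sD'.
    by apply/exists_inP; exists s.
  - by exists t.
  - by apply/touchP; exists z, y; rewrite in_setD zND zU sedge_sym.
  - rewrite touch_sym touchUl; apply/orP; right; apply: touchS tDz => //.
    by rewrite sub1set in_setD zND.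
  - by rewrite touch_sym touchUl touch_sym tWa.
have xSF := subsetP sU _ xU.
have ax : a -- x by rewrite sedge_sym.
have FW : far_side a x t \subset W.
  apply/subsetP => y; rewrite inE; apply: (connect_ind (P := mem W)) => //.
  move=> y1 y2 y1W /and3P[y12 _ y2D]; apply: (component_closed tD y1W _ y12).
  move: y2D; rewrite !in_setD in_set2 in_setU1 => /andP[/norP[y2a y2x] y2TF].
  rewrite y2TF andbT (negPf y2a) /=; apply: contra closed => y2U.
  apply/exists_inP; exists y1; [exact: y1W|]; apply/exists_inP; exists y2; rewrite // y12 y2x andbT.
  case/setUP: y2TF => // y2T; case/setUP: (subsetP sU _ y2U) => // y2S.
  by case: (disjointP _ _ ST _ y2S y2T).
have VF : V \subset far_side a x t.
  apply: component_max => //; apply/subsetP => y yV.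
  rewrite in_setD (subsetP sV) // andbT in_set2; apply/norP; split.
    by apply: contraNneq aNV => <-.
  by apply/eqP => e; apply: (UV x xU); rewrite -e.
have UN : U \subset near_side a x t.
  apply: component_max => //; apply/subsetP => y yU.
  rewrite in_setD (subsetP sU) // andbT in_setU1; apply/norP; split.
    by apply: contraNneq aNU => <-.
  by apply/negP => /(subsetP FW)/WN[_ /negP].
exists a, x, t, s, v, u1, v1.
rewrite /certificate aF xSF tT sS ax (subsetP UN s) // (subsetP VF v) // (subsetP UN u1) //.
by rewrite (subsetP VF v1) // uv sedge_sym va.
Qed.

End Linkage.

(** * Structured programs *)

Definition store := ((nat -> nat) * (nat -> nat))%type.

(* [For i c] runs [c] for i = 0, ..., L - 1, where L, the input length, is in
   register 0; register 1 is reserved for the loop test. *)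
Inductive cmd :=
| Prim of instr
| Seq of cmd & cmd
| If of nat & cmd
| For of nat & cmd.

(** The counter [0] is a placeholder: a well-formed command contains no jump as primitive. *)
Definition exec_prim (i : instr) (st : store) : store :=
  let s := exec_instr i (Config 0 st.1 st.2) in (reg s, ram s).

Definition for_test i st := exec_prim (ISub 1 0 i) st.
Definition for_next i st := exec_prim (IAdd i i 1) (exec_prim (IConst 1 1) st).

(** The loop test is executed once more on leaving the loop, as in the compiled code, so that the
    stores agree exactly, register 1 included. *)
Fixpoint exec (c : cmd) (st : store) : store :=
  match c with
  | Prim i => exec_prim i st
  | Seq c1 c2 => exec c2 (exec c1 st)
  | If r c1 => if st.1 r == 0 then st else exec c1 st
  | For i c1 =>
      for_test i (iter (st.1 0) (fun s => for_next i (exec c1 (for_test i s)))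
                       (exec_prim (IConst i 0) st))
  end.

Fixpoint csize (c : cmd) : nat :=
  match c with
  | Prim _ => 1
  | Seq c1 c2 => csize c1 + csize c2
  | If _ c1 => (csize c1).+1
  | For _ c1 => csize c1 + 6
  end.

Fixpoint code (c : cmd) (p : nat) : program :=
  match c with
  | Prim i => [:: i]
  | Seq c1 c2 => code c1 p ++ code c2 (p + csize c1)
  | If r c1 => IJumpZ r (p + (csize c1).+1) :: code c1 p.+1
  | For i c1 =>
      [:: IConst i 0; ISub 1 0 i; IJumpZ 1 (p + (csize c1 + 6))]
        ++ code c1 (p + 3) ++ [:: IConst 1 1; IAdd i i 1; IJump p.+1]
  end.

Fixpoint writes (c : cmd) (r : nat) : bool :=
  match c with
  | Prim (IConst d _) | Prim (IAdd d _ _) | Prim (ISub d _ _) | Prim (IRead d _) => r == d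
  | Prim _ => false
  | Seq c1 c2 => writes c1 r || writes c2 r
  | If _ c1 => writes c1 r
  | For i c1 => [|| r == i, r == 1 | writes c1 r]
  end.

(** Register 0 must keep the input length as long as a loop may follow. So it may be written only by
    a command with which a sequence ends: the answer is put there last. *)
Fixpoint well_formed (c : cmd) : bool :=
  match c with
  | Prim i => if i is (IJump _ | IJumpZ _ _) then false else true
  | Seq c1 c2 => [&& ~~ writes c1 0, well_formed c1 & well_formed c2]
  | If _ c1 => well_formed c1
  | For i c1 => [&& 1 < i, ~~ writes c1 0, ~~ writes c1 i & well_formed c1]
  end.

(** A round adds five steps to the body: subtraction and conditional jump of the test, two
    instructions for the increment, and the jump back. The remaining three are the initialization
    and the last test. *)
Fixpoint cost (c : cmd) (L : nat) : nat :=
  match c with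
  | Prim _ => 1
  | Seq c1 c2 => cost c1 L + cost c2 L
  | If _ c1 => (cost c1 L).+1
  | For _ c1 => L * (cost c1 L + 5) + 3
  end.

Lemma size_code c p : size (code c p) = csize c.
Proof.
elim: c p => [i|c1 IH1 c2 IH2|r c1 IH1|i c1 IH1] p //=.
- by rewrite size_cat IH1 IH2.
- by rewrite IH1.
- by rewrite size_cat IH1 /=; lia.
Qed.

Lemma exec_frame c st r : ~~ writes c r -> (exec c st).1 r = st.1 r.
Proof.
elim: c st => /= [i|c1 IH1 c2 IH2|r1 c1 IH1|i c1 IH1] st.
- by case: i => [d k|d i j|d i j|d i|i j|l|i l] //= /negPf h; rewrite /upd h.
- by rewrite negb_or => /andP[h1 h2]; rewrite IH2 ?IH1.
- by move=> h; case: ifP => // _; rewrite IH1.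
- rewrite !negb_or => /and3P[/negPf ri /negPf r1 h].
  rewrite {1}/upd r1.
  elim: (st.1 0) => [|k IHk] /=; first by rewrite /upd ri.
  by rewrite /upd ri r1 IH1 //= /upd r1.
Qed.

Lemma onth_cat_size (T : Type) (s t : seq T) (x : T) k :
  k = size s -> onth (s ++ x :: t) k = Some x.
Proof. by move=> ->; elim: s. Qed.

Lemma step_at (pre post P : program) (ins : instr) p r m :
  P = pre ++ ins :: post -> p = size pre ->
  step P (Config p r m) = exec_instr ins (Config p r m).
Proof. by move=> -> ->; rewrite /step /= onth_cat_size. Qed.

Lemma for_iterE L i c st k :
  ~~ writes c 0 -> ~~ writes c i -> 1 < i -> st.1 0 = L ->
  let s := iter k (fun s => for_next i (exec c (for_test i s)))
                  (exec_prim (IConst i 0) st) in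
  s.1 0 = L /\ s.1 i = k.
Proof.
move=> w0 wi i1 s0 /=.
have i0 : (0 == i) = false by case: i i1 {wi}.
have i1' : (i == 1) = false by case: i i1 {wi i0} => [|[]].
elim: k => [|k [IH1 IH2]] /=; first by rewrite /upd i0 eqxx.
rewrite /upd i0 eqxx i1' (exec_frame _ w0) (exec_frame _ wi) /= /upd /= i1' IH1 IH2; split => //; lia.
Qed.

Lemma code_correct c (pre post P : program) st :
  well_formed c -> P = pre ++ code c (size pre) ++ post ->
  exists2 t, t <= cost c (st.1 0) &
    iter t (step P) (Config (size pre) st.1 st.2) =
      Config (size pre + csize c) (exec c st).1 (exec c st).2.
Proof.
elim: c pre post st => /= [i|c1 IH1 c2 IH2|r c1 IH1|i c1 IH1] pre post st.
- move=> wf eP; exists 1 => //=; rewrite (step_at _ _ eP erefl).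
  by case: i wf eP => //= *; rewrite addn1.
- case/and3P=> w0 wf1 wf2 eP.
  have [|t1 ht1 e1] := IH1 pre (code c2 (size pre + csize c1) ++ post) st wf1.
    by rewrite eP -catA.
  have [|t2 ht2 e2] := IH2 (pre ++ code c1 (size pre)) post (exec c1 st) wf2.
    by rewrite eP size_cat size_code -!catA.
  exists (t2 + t1); first by move: ht2; rewrite exec_frame //; lia.
  by rewrite iterD e1; move: e2; rewrite size_cat size_code addnA => ->.
- move=> wf eP.
  have e0 : step P (Config (size pre) st.1 st.2) =
      Config (if st.1 r == 0 then size pre + (csize c1).+1 else (size pre).+1) st.1 st.2.
    by rewrite (step_at _ _ eP erefl).
  case: ifP e0 => r0 e0; first by exists 1 => //=; rewrite e0.
  have [|t ht e] := IH1 (rcons pre (IJumpZ r (size pre + (csize c1).+1))) post st wf.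
    by rewrite eP cat_rcons size_rcons.
  exists t.+1; first by rewrite ltnS.
  by rewrite iterSr e0; move: e; rewrite size_rcons => ->; rewrite addSn addnS.
- case/and4P=> i1 w0 wi wf eP.
  set p := size pre in eP *.
  pose body s := for_next i (exec c1 (for_test i s)).
  have ePt : P = rcons pre (IConst i 0) ++ ISub 1 0 i ::
      IJumpZ 1 (p + (csize c1 + 6)) :: code c1 (p + 3) ++
      IConst 1 1 :: IAdd i i 1 :: IJump p.+1 :: post.
    by rewrite eP cat_rcons -catA.
  have ePj : P = rcons (rcons pre (IConst i 0)) (ISub 1 0 i) ++
      IJumpZ 1 (p + (csize c1 + 6)) :: code c1 (p + 3) ++
      IConst 1 1 :: IAdd i i 1 :: IJump p.+1 :: post.
    by rewrite ePt [RHS]cat_rcons.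
  pose pre3 := rcons (rcons (rcons pre (IConst i 0)) (ISub 1 0 i))
                     (IJumpZ 1 (p + (csize c1 + 6))).
  have s3 : size pre3 = p + 3 by rewrite !size_rcons -/p; lia.
  have ePb : P = pre3 ++ code c1 (size pre3) ++
      IConst 1 1 :: IAdd i i 1 :: IJump p.+1 :: post.
    by rewrite ePj s3 [RHS]cat_rcons.
  have ePc : P = (pre3 ++ code c1 (size pre3)) ++
      IConst 1 1 :: IAdd i i 1 :: IJump p.+1 :: post by rewrite ePb catA.
  have ePd : P = rcons (pre3 ++ code c1 (size pre3)) (IConst 1 1) ++
      IAdd i i 1 :: IJump p.+1 :: post by rewrite ePc [RHS]cat_rcons.
  have ePe : P = rcons (rcons (pre3 ++ code c1 (size pre3)) (IConst 1 1)) (IAdd i i 1) ++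
      IJump p.+1 :: post by rewrite ePd [RHS]cat_rcons.
  have testE s : step P (Config p.+1 s.1 s.2) = Config p.+2 (for_test i s).1 (for_test i s).2.
    by rewrite (step_at _ _ ePt) ?size_rcons.
  have jumpE s : step P (Config p.+2 s.1 s.2) =
      Config (if s.1 1 == 0 then p + (csize c1 + 6) else p + 3) s.1 s.2.
    by rewrite (step_at _ _ ePj) ?size_rcons //= addn3.
  have nextE s : iter 3 (step P) (Config (p + 3 + csize c1) s.1 s.2) =
      Config p.+1 (for_next i s).1 (for_next i s).2.
    rewrite /= (step_at _ _ ePc) ?size_cat ?size_code ?s3 //=.
    rewrite (step_at _ _ ePd) ?size_rcons ?size_cat ?size_code ?s3 //=.
    by rewrite (step_at _ _ ePe) ?size_rcons ?size_cat ?size_code ?s3.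
  have inv k := for_iterE k w0 wi i1 erefl.
  (* The invariant is placed at the loop test, address [p.+1]; the additional [1] pays for the
     initialization of the counter. *)
  have loop k : k <= st.1 0 -> exists2 t, t <= k * (cost c1 (st.1 0) + 5) + 1 &
      iter t (step P) (Config p st.1 st.2) =
      let s := iter k body (exec_prim (IConst i 0) st) in Config p.+1 s.1 s.2.
    elim: k => [_|k IHk kL]; first by exists 1 => //=; rewrite (step_at _ _ eP).
    have [t ht e] := IHk (ltnW kL).
    pose s := iter k body (exec_prim (IConst i 0) st).
    have [s0 si] := inv st k; rewrite -/s in s0 si.
    have [t' ht' e'] := IH1 _ _ (for_test i s) wf ePb.
    exists (3 + (t' + (1 + (1 + t)))).
      by move: ht'; rewrite /= /upd /= s0; lia.
    rewrite !iterD e /= -/s testE jumpE.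
    have -> : ((for_test i s).1 1 == 0) = false by rewrite /= /upd /= s0 si; lia.
    by rewrite -s3 e' s3 -[RHS]nextE.
  have [t ht e] := loop _ (leqnn _).
  have [s0 si] := inv st (st.1 0); rewrite -/body in s0 si.
  exists (1 + (1 + t)); first lia.
  by rewrite !iterD e /= testE jumpE /= {1}/upd /= s0 si subnn.
Qed.

Lemma cost_poly c : exists K D, forall L, cost c L <= K * L ^ D + K.
Proof.
(* Powers of [L.+1] grow with the exponent even for [L = 0], so bounds can be added and multiplied
   freely. The factor [2 ^ D] comes from [L.+1 <= 2 * L] for positive [L]. *)
suff [K [D h]] : exists K D, forall L, cost c L <= K * L.+1 ^ D.
  exists (K * 2 ^ D), D => L; apply: leq_trans (h L) _.
  have [->|L0] := posnP L; first by rewrite exp1n; have := expn_gt0 2 D; nia.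
  rewrite -mulnA -expnMn; apply: leq_trans (leq_addr _ _).
  rewrite leq_mul2l; apply/orP; right.
  by case: (D) => // D'; rewrite leq_exp2r //; lia.
elim: c => /= [_|c1 [K1 [D1 h1]] c2 [K2 [D2 h2]]|_ c1 [K [D h]]|_ c1 [K [D h]]].
- by exists 1, 0.
- exists (K1 + K2), (D1 + D2) => L.
  rewrite mulnDl leq_add //; [apply: leq_trans (h1 L) _|apply: leq_trans (h2 L) _];
    by rewrite leq_mul2l leq_pexp2l ?orbT //; lia.
- exists K.+1, D => L; rewrite mulSn -add1n leq_add // expn_gt0 //.
- exists (K + 8), D.+1 => L; rewrite expnS.
  have := h L; have : 0 < L.+1 ^ D by rewrite expn_gt0.
  set q := _ ^ _; move: (cost c1 L) => x q0 hx.
  have h1 : L * x <= L * (K * q) by rewrite leq_mul.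
  have h2 : L.+1 <= L.+1 * q by rewrite leq_pmulr.
  nia.
Qed.

(** * Formulas with reachability *)

(** Variables are levels, not indices: the binder at depth [d] binds variable [d]. Names never shift
    under a binder, and each level can own registers and memory. [FReach] binds the target of each
    step of the path; its start is not tested. *)
Inductive formula :=
| FEq of nat & nat
| FEdge of nat & nat
| FNot of formula
| FAnd of formula & formula
| FEx of formula
| FReach of formula & nat & nat.

Definition bind (T : Type) (e : nat -> T) (d : nat) (v : T) : nat -> T :=
  fun i => if i == d then v else e i.

Fixpoint sat (G : sgraph) (d : nat) (e : nat -> G) (f : formula) : bool :=
  match f with
  | FEq i j => e i == e j
  | FEdge i j => e i -- e j
  | FNot f1 => ~~ sat d e f1
  | FAnd f1 f2 => sat d e f1 && sat d e f2
  | FEx f1 => [exists v : G, sat d.+1 (bind e d v) f1]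
  | FReach f1 i j =>
      connect (fun v w => v -- w && sat d.+1 (bind e d w) f1) (e i) (e j)
  end.

Fixpoint scoped (d : nat) (f : formula) : bool :=
  match f with
  | FEq i j | FEdge i j => (i < d) && (j < d)
  | FNot f1 => scoped d f1
  | FAnd f1 f2 => scoped d f1 && scoped d f2
  | FEx f1 => scoped d.+1 f1
  | FReach f1 i j => [&& i < d, j < d & scoped d.+1 f1]
  end.

Lemma sat_ext (G : sgraph) d (e e' : nat -> G) f :
  scoped d f -> (forall i, i < d -> e i = e' i) -> sat d e f = sat d e' f.
Proof.
have ext d' (u u' : nat -> G) v : (forall i, i < d' -> u i = u' i) ->
    forall i, i < d'.+1 -> bind u d' v i = bind u' d' v i.
  by move=> h i; rewrite /bind ltnS; case: (ltngtP i d') => // /h.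
elim: f d e e' => [i j|i j|f IH|f1 IH1 f2 IH2|f IH|f IH i j] d e e' /= sc h.
- by case/andP: sc => /h -> /h ->.
- by case/andP: sc => /h -> /h ->.
- by rewrite (IH _ _ e').
- by case/andP: sc => s1 s2; rewrite (IH1 _ _ e') // (IH2 _ _ e').
- by apply: eq_existsb => v; apply: IH => //; apply: ext.
- case/and3P: sc => /h -> /h -> sc; apply: eq_connect => v w.
  by congr (_ && _); apply: IH => //; apply: ext.
Qed.

Lemma sat_iter_FEx (G : sgraph) m d (e : nat -> G) f :
  scoped (d + m) f ->
  reflect (exists2 e', (forall i, i < d -> e i = e' i) & sat (d + m) e' f)
          (sat d e (iter m FEx f)).
Proof.
elim: m d e => [|m IH] d e /= sc.
  rewrite addn0 in sc *; apply: (iffP idP) => [h|[e' h1 h2]]; first by exists e.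
  by rewrite (@sat_ext _ _ _ e').
have sc' : scoped (d.+1 + m) f by rewrite addSnnS.
apply: (iffP existsP) => [[v /(IH _ _ sc')[e' h1 h2]]|[e' h1 h2]].
  exists e'; last by rewrite -addSnnS.
  by move=> i id; rewrite -h1 ?leqW // /bind ltn_eqF.
exists (e' d); apply/(IH _ _ sc'); exists e'; last by rewrite addSnnS.
by move=> i; rewrite /bind ltnS; case: (ltngtP i d) => // [/h1 ->|->].
Qed.

Lemma scoped_iter_FEx m d f : scoped d (iter m FEx f) = scoped (d + m) f.
Proof. by elim: m d => [|m IH] d /=; rewrite ?addn0 // IH addSnnS. Qed.

(** * Compilation of formulas to structured programs *)

Notation "c1 ;; c2" := (Seq c1 c2) (at level 60, right associativity).

Definition var d := 4 * d + 8.
Definition aux1 d := 4 * d + 9.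
Definition aux2 d := 4 * d + 10.
Definition aux3 d := 4 * d + 11.

(* Register 0 holds the input length L, 2 the number n of vertices, 3 the
   truth value of the last formula evaluated. *)
Definition edge_cmd x y :=
  Prim (IConst 4 1) ;; Prim (IAdd 4 4 2) ;;
  For 6 (Prim (ISub 5 x 6) ;; If 5 (Prim (IAdd 4 4 2))) ;;
  Prim (IAdd 4 4 y) ;; Prim (IRead 3 4).

(** The multiple of the input length depends on the depth only, so the additions are unrolled. The
    final [IConst] is a harmless end for the chain. *)
Definition add_input_size a k :=
  iter k (Seq (Prim (IAdd a a 0))) (Prim (IConst 4 0)).
Arguments add_input_size : simpl never.

Definition base_cmd d :=
  Prim (IConst (aux3 d) 0) ;; add_input_size (aux3 d) d.+1.

Definition mark_cmd d x b :=
  Prim (IAdd 4 (aux3 d) x) ;; Prim (IConst 5 b) ;; Prim (IWrite 4 5).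

(** Loop counters run up to [L], past the number of vertices. Only the target is compared with
    register 2: a source past the vertices is never marked, because those cells are kept at zero. *)
Definition relax_cmd d c :=
  Prim (ISub 4 2 (var d)) ;;
  If 4 (Prim (IAdd 4 (aux3 d) (aux2 d)) ;; Prim (IRead 4 4) ;;
        If 4 (edge_cmd (aux2 d) (var d) ;;
              If 3 (c ;; If 3 (mark_cmd d (var d) 1)))).

(* Level d owns the registers 4 d + 8, ..., 4 d + 11 and the memory cells from
   L (d + 1) to L (d + 2) - 1. Reachability is computed by relaxing every edge L times. *)
Fixpoint compile d f : cmd :=
  match f with
  | FEq i j =>
      Prim (ISub 4 (var i) (var j)) ;; Prim (ISub 5 (var j) (var i)) ;;
      Prim (IAdd 4 4 5) ;; Prim (IConst 3 1) ;; Prim (ISub 3 3 4)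
  | FEdge i j => edge_cmd (var i) (var j)
  | FNot f1 => compile d f1 ;; Prim (IConst 4 1) ;; Prim (ISub 3 4 3)
  | FAnd f1 f2 => compile d f1 ;; If 3 (compile d f2)
  | FEx f1 =>
      Prim (IConst (aux1 d) 0) ;;
      For (var d) (Prim (ISub 4 2 (var d)) ;;
                   If 4 (compile d.+1 f1 ;; If 3 (Prim (IConst (aux1 d) 1)))) ;;
      Prim (IConst 4 0) ;; Prim (IAdd 3 4 (aux1 d))
  | FReach f1 i j =>
      base_cmd d ;;
      For (var d) (mark_cmd d (var d) 0) ;;
      mark_cmd d (var i) 1 ;;
      For (aux1 d) (For (aux2 d) (For (var d) (relax_cmd d (compile d.+1 f1)))) ;;
      Prim (IAdd 4 (aux3 d) (var j)) ;; Prim (IRead 3 4)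
  end.

(** These are the registers that a formula at depth [d] may overwrite; the length, the number of
    vertices and the variables of outer levels are spared. Registers 3 to 6 are shared by all
    levels, so what must survive a subformula is kept in registers of the level. *)
Definition scratch d r := [|| r == 1, 2 < r < 7 | 4 * d + 8 <= r].

Lemma writes_compile d f r : writes (compile d f) r -> scratch d r.
Proof.
elim: f d r => [i j|i j|f IH|f1 IH1 f2 IH2|f IH|f IH i j] d r;
  rewrite /compile -/compile /edge_cmd /relax_cmd /mark_cmd /base_cmd /=
    /scratch /var /aux1 /aux2 /aux3.
- lia.
- lia.
- by case/or3P => [/IH //||]; rewrite /scratch; lia.
- by case/orP=> [/IH1|/IH2].
- have := IH d.+1 r; rewrite /scratch; lia.
- have b k : writes (add_input_size (4 * d + 11) k) r -> (r == 4) || (r == 4 * d + 11).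
    by rewrite /add_input_size; elim: k => [|k IHk] /=; lia.
  have := b d.
  have := IH d.+1 r; rewrite /scratch; lia.
Qed.

Lemma well_formed_compile d f : well_formed (compile d f).
Proof.
have nw d' g (r : nat) : ~~ scratch d' r -> ~~ writes (compile d' g) r.
  exact/contra/writes_compile.
elim: f d => [i j|i j|f IH|f1 IH1 f2 IH2|f IH|f IH i j] d //=;
  rewrite /compile -/compile /edge_cmd /relax_cmd /mark_cmd /base_cmd /=
    /var /aux1 /aux2 /aux3 ?IH ?IH1 ?IH2 //=.
- by have := nw d f 0; rewrite /scratch; lia.
- by have := nw d f1 0; rewrite /scratch; lia.
- have := @nw d.+1 f 0; have := @nw d.+1 f (4 * d + 8).
  rewrite /scratch; lia.
- have b r k : r <> 4 -> r <> 4 * d + 11 ->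
    ~~ writes (add_input_size (4 * d + 11) k) r.
    by rewrite /add_input_size; elim: k => [|k IHk] /=; lia.
  have w k : well_formed (add_input_size (4 * d + 11) k).
    by rewrite /add_input_size; elim: k => [|k IHk] //=; rewrite IHk; lia.
  have := @nw d.+1 f 0; have := @nw d.+1 f (4 * d + 8).
  have := @nw d.+1 f (4 * d + 9); have := @nw d.+1 f (4 * d + 10).
  have := b 0 d; have := b (4 * d + 8) d; have := w d.
  have := b (4 * d + 9) d; have := b (4 * d + 10) d.
  rewrite /scratch; lia.
Qed.

(** The loop control changes registers 1 and [i] between rounds, hence the invariant has to ignore
    them. What the loop never writes is handed to the step premise, so that the invariant need not
    record it. *)
Lemma for_rule i c st (I : nat -> store -> Prop) :
  well_formed (For i c) ->
  (forall k s s', (forall r, r <> 1 -> r <> i -> s.1 r = s'.1 r) -> s.2 = s'.2 ->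
     I k s -> I k s') ->
  I 0 st ->
  (forall k s, k < st.1 0 -> s.1 i = k ->
     (forall r, ~~ writes (For i c) r -> s.1 r = st.1 r) ->
     I k s -> I k.+1 (exec c s)) ->
  I (st.1 0) (exec (For i c) st).
Proof.
move=> /and4P[i1 w0 wi _] Iext I0 IS /=.
have i0 : i <> 0 by lia.
have eN a b : a <> b -> (a == b) = false by move=> /eqP /negPf.
pose s k := iter k (fun s => for_next i (exec c (for_test i s)))
                   (exec_prim (IConst i 0) st).
have sE k := for_iterE k w0 wi i1 (erefl (st.1 0)).
have test_ext k u : I k u -> I k (for_test i u).
  by apply: Iext => // r r1 ri; rewrite /= /upd eN.
have Is k : k <= st.1 0 -> I k (s k) /\
    (forall r, ~~ writes (For i c) r -> (s k).1 r = st.1 r).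
  elim: k => [_|k IHk kL]; split.
  - by apply: Iext I0 => // r r1 ri; rewrite /= /upd eN.
  - by move=> r /=; rewrite /upd negb_or => /andP[/negPf->].
  - have [Ik fk] := IHk (ltnW kL); have [s0 si] := sE k.
    apply: (Iext _ (exec c (for_test i (s k)))) => //.
      by move=> r r1 ri; rewrite /= /upd !eN.
    apply: IS => //; last exact: test_ext.
      by rewrite /= /upd eN; [exact: si|lia].
    move=> r wr; rewrite -fk //= /upd eN // => r1.
    by move: wr; rewrite r1 /= orbT.
  - move=> r wr; have [_ fk] := IHk (ltnW kL); rewrite -fk //.
    move: wr; rewrite /= !negb_or => /and3P[/negPf ri /negPf r1 wr].
    by rewrite /= /upd ri r1 exec_frame //= /upd r1.
exact/test_ext/(proj1 (Is _ (leqnn _))).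
Qed.

(** * Correctness of the compilation *)

Section Compile.
Variables (G : sgraph) (vs : seq G) (L : nat).
Hypotheses (vs_uniq : uniq vs) (vsT : forall x : G, x \in vs).

Let n := size vs.
Let idx (x : G) := index x vs.

Hypothesis nL : n.+1 + n * n <= L.

Let n_le : n <= L. Proof. by apply: leq_trans nL; rewrite addSn -addnS leq_addr. Qed.

Let idx_lt x : idx x < n. Proof. by rewrite /idx index_mem vsT. Qed.

Let idx_inj : injective idx.
Proof. by move=> x y; apply: index_inj. Qed.

Let idx_surj k : k < n -> exists v, idx v = k.
Proof.
move=> kn; have x0 : G by move: kn; rewrite /n; case: (vs).
by exists (nth x0 vs k); rewrite /idx index_uniq.
Qed.

Definition represents d (e : nat -> G) (st : store) : Prop :=
  [/\ st.1 0 = L, st.1 2 = n, forall i, i < d -> st.1 (var i) = idx (e i)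
    & forall x y, st.2 (n.+1 + idx x * n + idx y) = (x -- y) :> nat].

(** The cells below [L * d.+1] hold the input and the marks of the levels below [d]. *)
Definition same_ram d (st st' : store) : Prop :=
  forall a, a < L * d.+1 -> st'.2 a = st.2 a.

Lemma same_ramW d st st' : same_ram d.+1 st st' -> same_ram d st st'.
Proof. by move=> h a ha; apply: h; nia. Qed.

Lemma same_ram_trans d st1 st2 st3 :
  same_ram d st1 st2 -> same_ram d st2 st3 -> same_ram d st1 st3.
Proof. by move=> h1 h2 a ha; rewrite h2 ?h1. Qed.

Lemma represents_frame d e st st' :
  (forall r, ~~ scratch d r -> st'.1 r = st.1 r) -> same_ram d st st' ->
  represents d e st -> represents d e st'.
Proof.
move=> hr hm [h0 h2 hv ha]; split.
- by rewrite hr // /scratch; lia.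
- by rewrite hr // /scratch; lia.
- by move=> i id; rewrite -hv // hr // /scratch /var; lia.
- move=> x y; rewrite -ha hm //; have := idx_lt x; have := idx_lt y; nia.
Qed.

Lemma represents_bind d e st v :
  represents d e st -> st.1 (var d) = idx v -> represents d.+1 (bind e d v) st.
Proof.
case=> h0 h2 hv ha hd; split=> // i; rewrite ltnS /bind.
by case: (ltngtP i d) => // [/hv->|->].
Qed.

(** For want of multiplication, the address is obtained by adding [n] once for each counter value
    below [idx x]. It starts from [n.+1], the length of the unary prefix with its separator. *)
Lemma exec_edge_cmd rx ry (st : store) x y :
  6 < rx -> 6 < ry -> st.1 0 = L -> st.1 2 = n ->
  st.1 rx = idx x -> st.1 ry = idx y ->
  (forall x y, st.2 (n.+1 + idx x * n + idx y) = (x -- y) :> nat) ->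
  (exec (edge_cmd rx ry) st).1 3 = (x -- y) :> nat /\ (exec (edge_cmd rx ry) st).2 = st.2.
Proof.
move=> rx6 ry6 s0 s2 sx sy sa.
pose st1 := exec (Prim (IConst 4 1) ;; Prim (IAdd 4 4 2)) st.
pose c := Prim (ISub 5 rx 6) ;; If 5 (Prim (IAdd 4 4 2)).
have w : well_formed (For 6 c) by rewrite /c /=; lia.
have [||k s ks s6 fr [s4 sm]|s4 sm] := @for_rule 6 c st1
  (fun k s => s.1 4 = n.+1 + minn k (idx x) * n /\ s.2 = st.2) w.
- by move=> k s s' e1 e2 [h1 h2]; rewrite -e1 // -e2.
- by rewrite min0n /= /upd /= s2; split=> //; lia.
- have s2' : s.1 2 = n by rewrite fr //= /upd /=.
  have sx' : s.1 rx = idx x.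
    by rewrite fr /= /upd; last lia; rewrite !ifN //; lia.
  rewrite /= /upd /= sx' s6; case: eqP => e; rewrite /= /upd /= ?s2' s4;
    split=> //.
    by congr (_ + _ * _); lia.
  by rewrite -addnA -mulSnr; congr (_ + _ * _); lia.
- have -> : edge_cmd rx ry = Prim (IConst 4 1) ;; Prim (IAdd 4 4 2) ;; For 6 c ;;
      Prim (IAdd 4 4 ry) ;; Prim (IRead 3 4) by [].
  have sy' : (exec (For 6 c) st1).1 ry = idx y.
    rewrite exec_frame; last by rewrite /=; lia.
    by rewrite /= /upd !ifN //; lia.
  have s10 : st1.1 0 = L by rewrite /= /upd /=.
  rewrite s10 in s4 *.
  change (exec _ st) with
    (exec (Prim (IAdd 4 4 ry) ;; Prim (IRead 3 4)) (exec (For 6 c) st1)).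
  move: (exec (For 6 c) st1) s4 sm sy' => s s4 sm sy'.
  rewrite /= /upd /= s4 sy' sm; split=> //; rewrite -sa; congr (st.2 (_ + _ * _ + _)).
  have := idx_lt x; nia.
Qed.

Lemma exec_Seq c1 c2 st : exec (c1 ;; c2) st = exec c2 (exec c1 st).
Proof. by []. Qed.

Lemma exec_If r c st : exec (If r c) st = if st.1 r == 0 then st else exec c st.
Proof. by []. Qed.

Lemma exec_base_cmd d st : st.1 0 = L ->
  (exec (base_cmd d) st).1 (aux3 d) = L * d.+1 /\ (exec (base_cmd d) st).2 = st.2.
Proof.
have H k a s : 4 < a -> s.1 0 = L -> (exec (add_input_size a k) s).1 a = s.1 a + L * k /\
    (exec (add_input_size a k) s).2 = s.2.
  move=> a4; rewrite /add_input_size; elim: k s => [|k IH] s s0 /=.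
    by rewrite /upd ifN ?muln0 ?addn0 //; lia.
  have [|-> ->] /= := IH (exec_prim (IAdd a a 0) s); first by rewrite /= /upd ifN //; lia.
  by rewrite /upd eqxx s0; split=> //; lia.
move=> s0; rewrite /base_cmd exec_Seq.
have [||-> ->] := H d.+1 (aux3 d) (exec (Prim (IConst (aux3 d) 0)) st).
- by rewrite /aux3; lia.
- by rewrite /= /upd ifN // /aux3; lia.
- by rewrite /= /upd eqxx.
Qed.

Lemma exec_mark_cmd d x b st : x <> 4 ->
  (exec (mark_cmd d x b) st).2 = upd st.2 (st.1 (aux3 d) + st.1 x) b.
Proof. by []. Qed.

(** * Reachability by repeated relaxation *)

Definition marks d (st : store) (m : pred G) : Prop :=
  (forall v, st.2 (L * d.+1 + idx v) = m v :> nat) /\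
  (forall c, n <= c < L -> st.2 (L * d.+1 + c) = 0).

Section Relax.
Variables (d : nat) (f : formula) (e : nat -> G).
Hypothesis exec_f : forall v st, represents d.+1 (bind e d v) st ->
  (exec (compile d.+1 f) st).1 3 = sat d.+1 (bind e d v) f :> nat /\
  same_ram d.+1 st (exec (compile d.+1 f) st).

Definition arc v w := v -- w && sat d.+1 (bind e d w) f.

Lemma same_ram_marks st st' m :
  same_ram d.+1 st st' -> marks d st m -> marks d st' m.
Proof.
move=> h [h1 h2]; split=> [v|c hc]; rewrite h ?h1 ?h2 //.
  have := idx_lt v; nia.
lia.
Qed.

Lemma exec_relax_cmd s m z :
  represents d e s -> s.1 (aux3 d) = L * d.+1 -> s.1 (aux2 d) = z -> z < L ->
  marks d s m ->
  let s' := exec (relax_cmd d (compile d.+1 f)) s in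
  same_ram d s s' /\
  exists2 m', marks d s' m' &
    [/\ forall v, m v -> m' v,
        forall w, m' w -> m w \/ exists2 v, m v & arc v w
      & forall v w, idx v = z -> idx w = s.1 (var d) -> m v -> arc v w -> m' w].
Proof.
move=> hs h3 hz zL hm s'; rewrite /s' {s'} /relax_cmd exec_Seq.
(* This covers all cases in which nothing gets marked: the old marking still fits if the pair at
   hand is not an arc from a marked vertex. *)
have keep s' : same_ram d.+1 s s' ->
    (forall v w, idx v = z -> idx w = s.1 (var d) -> m v -> ~~ arc v w) ->
    same_ram d s s' /\
    exists2 m', marks d s' m' &
    [/\ forall v, m v -> m' v,
        forall w, m' w -> m w \/ exists2 v, m v & arc v w
      & forall v w, idx v = z -> idx w = s.1 (var d) -> m v -> arc v w -> m' w].
  move=> h1 h2; split; first exact: same_ramW.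
  exists m; first exact: same_ram_marks h1 hm.
  by split=> // [w|v w hv hw mv /negPn]; [left|rewrite h2].
have [hs0 hs2 _ hsa] := hs.
have fr c : (forall r, writes c r -> scratch d r && (r < 7)) -> forall s' r,
    [\/ r = 0, r = 2 | 6 < r] -> (exec c s').1 r = s'.1 r.
  by move=> h s' r [] hr; rewrite exec_frame //; apply/negP => /h; rewrite /scratch; lia.
set s1 := exec (Prim (ISub 4 2 (var d))) s.
have e1 r : r <> 4 -> s1.1 r = s.1 r by move=> /eqP r4; rewrite /s1 exec_frame.
have m1 : s1.2 = s.2 by [].
have e14 : s1.1 4 = n - s.1 (var d) by rewrite /= /upd /= hs2.
rewrite exec_If e14; case: eqP => [nx|xn].
  by apply: keep => // v w _ hw; have := idx_lt w; lia.
have [w hw] : exists w, idx w = s.1 (var d) by apply: idx_surj; lia.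
rewrite !exec_Seq exec_If; set s2 := exec (Prim (IRead 4 4)) _.
have e2 r : r <> 4 -> s2.1 r = s.1 r.
  by move=> /eqP r4; rewrite /s2 !exec_frame.
have m2 : s2.2 = s.2 by [].
have e24 : s2.1 4 = s.2 (L * d.+1 + z).
  rewrite /= {1}/upd /= {1}/upd /= -?[upd _ _ _ _]/(s1.1 _) !e1 ?h3 ?hz // /aux2 /aux3; lia.
rewrite e24; case: eqP => [mz|mz].
  apply: keep => // v w' hv _ mv; apply: contra_eqT mz => _.
  by rewrite -hv (proj1 hm) mv.
have [zn|nz] := ltnP z n; last by case: mz; apply: (proj2 hm); rewrite nz.
have [v hv] := idx_surj zn.
have mv : m v by move: mz; rewrite -hv (proj1 hm); case: (m v).
rewrite exec_Seq; set s3 := exec (edge_cmd _ _) s2.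
have [e33 m3] : s3.1 3 = (v -- w) :> nat /\ s3.2 = s2.2.
  apply: exec_edge_cmd; rewrite ?e2 ?m2 ?hz //; rewrite /aux2 /var; lia.
have e3 r : [\/ r = 0, r = 2 | 6 < r] -> s3.1 r = s.1 r.
  by move=> hr; rewrite /s3 fr //; [apply: e2; case: hr; lia | rewrite /= /scratch; lia].
rewrite exec_If e33; have [vw|vw] /= := boolP (v -- w); last first.
  apply: keep => [|v' w' hv' hw' _]; first by move=> a _; rewrite m3 m2.
  by rewrite -hw in hw'; rewrite -hv in hv'; rewrite /arc (idx_inj hv') (idx_inj hw') (negPf vw).
have rep3 : represents d.+1 (bind e d w) s3.
  apply: represents_bind; last by rewrite e3 //; apply: Or33; rewrite /var; lia.
  case: hs => h0' h2' hv' ha'; split; rewrite ?e3 ?m3 ?m2 //; try by [apply: Or31|apply: Or32].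
  by move=> i id; rewrite e3 ?hv' //; apply: Or33; rewrite /var; lia.
have [e43 m4] := exec_f rep3; set s4 := exec (compile _ _) s3 in e43 m4 *.
have m4' : same_ram d.+1 s s4 by move=> a ha; rewrite m4 // m3.
rewrite e43; have [sw|sw] := boolP (sat _ _ f); last first.
  apply: keep => // v' w' hv' hw' _; rewrite -hw in hw'; rewrite /arc (idx_inj hw').
  by rewrite (negPf sw) andbF.
have m5 : (exec (mark_cmd d (var d) 1) s4).2 = upd s4.2 (L * d.+1 + idx w) 1.
  rewrite exec_mark_cmd; last by rewrite /var; lia.
  have fr4 r : ~~ scratch d.+1 r -> s4.1 r = s3.1 r.
    by move=> sr; rewrite /s4 exec_frame //; apply: contra sr; apply: writes_compile.
  by rewrite !fr4 ?e3 ?h3 ?hw //; first [apply: Or33|rewrite /scratch]; rewrite /aux3 /var; lia.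
have [k1 k2] := same_ram_marks m4' hm.
split=> [a ha|].
  by rewrite m5 /upd ifN ?m4' //; have := idx_lt w; nia.
exists [pred u | m u || (u == w)]; last split=> /=.
- split=> [u|c hc]; rewrite m5 /upd /=.
    by rewrite eqn_add2l (inj_eq idx_inj) k1; case: (u == w); rewrite ?orbT ?orbF.
  by rewrite ifN ?k2 //; have := idx_lt w; lia.
- by move=> u ->.
- move=> u /orP[|/eqP->]; [by left|right; exists v => //].
  by rewrite /arc vw.
- move=> v' w' _ hw' _ _; rewrite -hw in hw'.
  by rewrite (idx_inj hw') eqxx orbT.
Qed.


(** A mark set during a round is already used in the same round, so the marking after [k] rounds is
    only bounded from both sides: it contains the ends of paths of length at most [k] and consists
    of reachable vertices. The bounds meet after [L] rounds, since a path without repetition has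
    fewer than [n] arcs. *)
Lemma exec_relax_loop s m :
  represents d e s -> s.1 (aux3 d) = L * d.+1 -> marks d s m ->
  let s' := exec (For (aux1 d) (For (aux2 d) (For (var d) (relax_cmd d (compile d.+1 f))))) s in
  same_ram d s s' /\
  exists2 m', marks d s' m' & forall w, m' w = [exists v, m v && connect arc v w].
Proof.
move=> hs s3 hm.
set c3 := relax_cmd _ _; set c2 := For (var d) c3; set c1 := For (aux2 d) c2.
have wf : well_formed (For (aux1 d) c1).
  by case/and3P: (well_formed_compile d (FReach f 0 0))
    => _ _ /and3P[_ _ /and3P[_ _ /and3P[_ h _]]].
have /and4P[_ _ _ wf1] := wf; have /and4P[_ _ _ wf2] := wf1.
have w1 r : writes (For (aux1 d) c1) r -> scratch d r && (r != aux3 d).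
  have := @writes_compile d.+1 f r.
  by rewrite /= /scratch /var /aux1 /aux2 /aux3; lia.
have w2 r : writes c1 r -> scratch d r && (r != aux3 d).
  by move=> h; apply: w1; apply/or3P; apply: Or33.
have w3 r : writes c2 r -> [&& scratch d r, r != aux3 d & r != aux2 d].
  have := @writes_compile d.+1 f r.
  by rewrite /= /scratch /var /aux1 /aux2 /aux3; lia.
have rep u u' : represents d e u -> same_ram d u u' ->
    (forall r, ~~ scratch d r -> u'.1 r = u.1 r) -> represents d e u'.
  by move=> h1 h2 h3; apply: represents_frame h1.
have markse u u' m' : u.2 = u'.2 -> marks d u m' -> marks d u' m'.
  by rewrite /marks => ->.
have rame t u u' : u.2 = u'.2 -> same_ram d t u -> same_ram d t u'.
  by rewrite /same_ram => ->.
pose sound (m1 m2 : pred G) := forall w, m2 w -> exists2 v, m1 v & connect arc v w.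
have sound_trans m1 m2 m3 : sound m1 m2 -> sound m2 m3 -> sound m1 m3.
  move=> h1 h2 w /h2[v /h1[u mu uv] vw]; exists u => //; exact: connect_trans vw.
have inner z u m1 : z < L -> represents d e u -> u.1 (aux3 d) = L * d.+1 ->
    u.1 (aux2 d) = z -> marks d u m1 ->
    same_ram d u (exec c2 u) /\
    exists2 m2, marks d (exec c2 u) m2 &
      [/\ forall v, m1 v -> m2 v, sound m1 m2
        & forall v w, idx v = z -> m1 v -> arc v w -> m2 w].
  move=> zL hu u3 uz hm1.
  have u0 : u.1 0 = L by case: hu.
  pose I x t := same_ram d u t /\ exists2 m2, marks d t m2 &
      [/\ forall v, m1 v -> m2 v, sound m1 m2
        & forall v w, idx v = z -> idx w < x -> m1 v -> arc v w -> m2 w].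
  have [||x t xL tx fr [ht [m2 hm2 [le12 s12 r12]]]|] := @for_rule _ _ u I wf2.
  - move=> k t t' _ e2 [h1 [m2 h2 h3]]; split; first exact: rame h1.
    by exists m2 => //; apply: markse h2.
  - split=> //; exists m1 => //; split=> // w mw; exists w => //.
  - have [|||ht' [m3 hm3 [le23 s23 r23]]] := @exec_relax_cmd t m2 z _ _ _ zL hm2.
    + apply: rep hu ht _ => r sr; apply: fr; apply: contra sr.
      by case/w3/andP.
    + by rewrite fr //; apply/negP => /w3; rewrite eqxx /= andbF.
    + by rewrite fr //; apply/negP => /w3; rewrite eqxx /= !andbF.
    split; first exact: same_ram_trans ht ht'.
    exists m3 => //; split=> [v /le12/le23 //||v w hv].
      apply: sound_trans s12 _ => w /s23[mw|[v mv vw]]; first by exists w.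
      by exists v => //; apply: connect1.
    rewrite ltnS leq_eqVlt tx in r23 *; case/orP=> [/eqP hw mv vw|hw mv vw].
      by apply: (r23 v w) => //; apply: le12.
    by apply/le23/(r12 v).
  rewrite u0 => hc [m2 hm2 [h1 h2 h3]]; split=> //; exists m2 => //; split=> // v w hv.
  by apply: h3 => //; apply: leq_trans n_le.
have middle u m1 : represents d e u -> u.1 (aux3 d) = L * d.+1 ->  marks d u m1 ->
    same_ram d u (exec c1 u) /\
    exists2 m2, marks d (exec c1 u) m2 &
      [/\ forall v, m1 v -> m2 v, sound m1 m2
        & forall v w, m1 v -> arc v w -> m2 w].
  move=> hu u3 hm1.
  have u0 : u.1 0 = L by case: hu.
  pose I x t := same_ram d u t /\ exists2 m2, marks d t m2 &
      [/\ forall v, m1 v -> m2 v, sound m1 m2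
        & forall v w, idx v < x -> m1 v -> arc v w -> m2 w].
  have [||x t xL tx fr [ht [m2 hm2 [le12 s12 r12]]]|] := @for_rule _ _ u I wf1.
  - move=> k t t' _ e2 [h1 [m2 h2 h3]]; split; first exact: rame h1.
    by exists m2 => //; apply: markse h2.
  - split=> //; exists m1 => //; split=> // w mw; exists w => //.
  - have [|||ht' [m3 hm3 [le23 s23 r23]]] := @inner x t m2 _ _ _ tx hm2.
    + by rewrite -u0.
    + apply: rep hu ht _ => r sr; apply: fr; apply: contra sr.
      by case/w2/andP.
    + by rewrite fr //; apply/negP => /w2; rewrite eqxx /= andbF.
    split; first exact: same_ram_trans ht ht'.
    exists m3 => //; split=> [v /le12/le23 //||v w].
      exact: sound_trans s12 s23.
    rewrite ltnS leq_eqVlt; case/orP=> [/eqP hv mv vw|hv mv vw].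
      by apply: (r23 v w) => //; apply: le12.
    by apply/le23/(r12 v).
  rewrite u0 => hc [m2 hm2 [h1 h2 h3]]; split=> //; exists m2 => //; split=> // v w.
  by apply: h3; apply: leq_trans n_le.
have s0 : s.1 0 = L by case: hs.
pose I k t := same_ram d s t /\ exists2 m2, marks d t m2 &
    sound m m2 /\ forall v p, m v -> path arc v p -> size p <= k -> m2 (last v p).
have [||x t xL tx fr [ht [m2 hm2 [s2 r2]]]|] := @for_rule _ _ s I wf.
- move=> k t t' _ e2 [h1 [m2 h2 h3]]; split; first exact: rame h1.
  by exists m2 => //; apply: markse h2.
- split=> //; exists m => //; split=> [w mw|v [|]//]; by exists w.
- have [||ht' [m3 hm3 [le23 s23 r23]]] := @middle t m2 _ _ hm2.
  + by apply: rep hs ht _ => r sr; apply: fr; apply: contra sr => /w1/andP[].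
  + by rewrite fr //; apply/negP => /w1; rewrite eqxx /= andbF.
  split; first exact: same_ram_trans ht ht'.
  exists m3 => //; split; first exact: sound_trans s2 s23.
  move=> v p; case/lastP: p => [mv _ _|p w mv]; first exact/le23/(r2 v [::]).
  rewrite rcons_path last_rcons size_rcons ltnS => /andP[vp pw] sp.
  by apply: r23 pw; apply: r2.
rewrite s0 => hc [m2 hm2 [h1 h2]]; split=> //; exists m2 => // w.
apply/idP/existsP => [/h1[v mv vw]|[v /andP[mv /connectP[p vp ->]]]].
  by exists v; rewrite mv.
case/shortenP: vp => p' vp' up' _; apply: h2 => //.
have : size (v :: p') <= size vs by apply: uniq_leq_size.
by rewrite /= => /ltnW h; apply: leq_trans h _.
Qed.

Lemma exec_reach i j st : i < d -> j < d -> represents d e st ->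
  (exec (compile d (FReach f i j)) st).1 3 = connect arc (e i) (e j) :> nat /\
  same_ram d st (exec (compile d (FReach f i j)) st).
Proof.
move=> id jd hst; rewrite [compile d _]/= !exec_Seq.
set c4 := For (aux1 d) _.
set c2 := For (var d) _.
have w4 r : writes c4 r -> scratch d r && (r != aux3 d).
  have := @writes_compile d.+1 f r.
  by rewrite /= /scratch /var /aux1 /aux2 /aux3; lia.
have [st0 _ stv _] := hst.
have [e1 m1] := exec_base_cmd d st0; set s1 := exec (base_cmd d) st in e1 m1 *.
have w1 r : writes (base_cmd d) r -> scratch d r.
  by have := @writes_compile d (FReach f i j) r; rewrite [compile _ _]/= /=; lia.
have rep1 : represents d e s1.
  apply: represents_frame hst => [r sr|a _]; last by rewrite m1.
  by rewrite /s1 exec_frame //; apply: contra sr; apply: w1.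
have wf2 : well_formed c2.
  by rewrite /= /var; lia.
(* Marks from an earlier evaluation at this level may still be in memory, for instance inside a
   loop, hence the clearing. It runs up to [L], so the cells past the vertices become zero as
   well. *)
pose I k s := same_ram d st s /\ forall c, c < k -> s.2 (L * d.+1 + c) = 0.
have [||k s ks sk fr [ha hz]|sr1 hz] := @for_rule _ _ s1 I wf2.
- by move=> k t t' _ e2; rewrite /I /same_ram e2.
- by split=> // a _; rewrite m1.
- have e3 : s.1 (aux3 d) = L * d.+1.
    by rewrite fr // /= /var /aux3; lia.
  have s10 : s1.1 0 = L by case: rep1.
  rewrite s10 in ks.
  have em : (exec (mark_cmd d (var d) 0) s).2 = upd s.2 (L * d.+1 + k) 0.
    by rewrite exec_mark_cmd ?e3 ?sk // /var; lia.
  split=> [a la|c ck]; rewrite em /upd; first by rewrite ifN ?ha //; lia.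
  by case: eqP => // ne; apply: hz; lia.
have s10 : s1.1 0 = L by case: rep1.
rewrite s10 in hz; rewrite -/c2 in sr1 hz.
set s2 := exec c2 s1 in sr1 hz *.
have w2 r : writes c2 r -> scratch d r && (r != aux3 d).
  by rewrite /= /scratch /var /aux3; lia.
have rep2 : represents d e s2.
  apply: represents_frame hst => // r sr.
  rewrite /s2 exec_frame; last by apply: contra sr => /w2/andP[].
  by rewrite /s1 exec_frame //; apply: contra sr; apply: w1.
have e2 : s2.1 (aux3 d) = L * d.+1.
  by rewrite /s2 exec_frame //; apply/negP => /w2; rewrite eqxx andbF.
set s3 := exec (mark_cmd d (var i) 1) s2.
have [_ _ s2v _] := rep2.
have em : s3.2 = upd s2.2 (L * d.+1 + idx (e i)) 1.
  by rewrite /s3 exec_mark_cmd ?e2 ?s2v // /var; lia.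
have w3 r : writes (mark_cmd d (var i) 1) r -> scratch d r && (r != aux3 d).
  by rewrite /= /scratch /aux3; lia.
have sr3 : same_ram d st s3.
  by move=> a la; rewrite em /upd ifN ?sr1 //; lia.
have rep3 : represents d e s3.
  apply: represents_frame rep2 => [r sr|a la]; last by rewrite sr3 ?sr1.
  by rewrite /s3 exec_frame //; apply: contra sr => /w3/andP[].
have e3 : s3.1 (aux3 d) = L * d.+1.
  by rewrite /s3 exec_frame //; apply/negP => /w3; rewrite eqxx andbF.
have hm : marks d s3 (pred1 (e i)).
  split=> [v|c hc]; rewrite em /upd eqn_add2l.
    by rewrite [pred1 _ _]/= (inj_eq idx_inj); case: eqP => // _; apply: hz; apply: leq_trans n_le.
  case/andP: hc => nc cL; rewrite ifN ?hz //.
  by apply/eqP => ce; have := idx_lt (e i); rewrite -ce ltnNge nc.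
have [sr4 [m4 hm4 m4E]] := exec_relax_loop rep3 e3 hm.
rewrite -/c4 in sr4 hm4; set s4 := exec c4 s3 in sr4 hm4 *.
have e4 : s4.1 (aux3 d) = L * d.+1.
  by rewrite /s4 exec_frame //; apply/negP => /w4; rewrite eqxx andbF.
have v4 : s4.1 (var j) = idx (e j).
  have [_ _ s3v _] := rep3; rewrite /s4 exec_frame ?s3v //.
  by apply/negP => /w4; rewrite /scratch /var; lia.
split; last exact: same_ram_trans sr3 sr4.
have -> s : (exec (Prim (IRead 3 4)) (exec (Prim (IAdd 4 (aux3 d) (var j))) s)).1 3 =
    s.2 (s.1 (aux3 d) + s.1 (var j)) by [].
rewrite e4 v4 (proj1 hm4) m4E; congr nat_of_bool.
apply/existsP/idP => [[v /andP[/eqP-> //]]|h].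
by exists (e i); rewrite /= eqxx.
Qed.
End Relax.

Lemma compile_correct d f e st : scoped d f -> represents d e st ->
  (exec (compile d f) st).1 3 = sat d e f :> nat /\
  same_ram d st (exec (compile d f) st).
Proof.
have idx_eq x y : (idx x == idx y) = (x == y) by rewrite (inj_eq idx_inj).
elim: f d e st => [i j|i j|f IH|f1 IH1 f2 IH2|f IH|f IH i j] d e st.
- case/andP=> id jd [st0 _ stv _]; split=> [|a _ //].
  have -> : (exec (compile d (FEq i j)) st).1 3 =
      1 - (st.1 (var i) - st.1 (var j) + (st.1 (var j) - st.1 (var i))).
    rewrite /= /upd /= !ifN // /var; lia.
  by rewrite !stv //= -idx_eq; case: eqP; lia.
- case/andP=> id jd [st0 st2 stv sta].
  have [||h1 h2] := @exec_edge_cmd (var i) (var j) st (e i) (e j) _ _ st0 st2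
    (stv _ id) (stv _ jd) sta.
  - by rewrite /var; lia.
  - by rewrite /var; lia.
  by split=> // a _; rewrite [compile _ _]/= h2.
- move=> sc hst; have [h1 h2] := IH _ _ _ sc hst.
  split=> [|a la]; last exact: h2.
  rewrite [compile _ _]/= exec_Seq; move: (exec _ st) h1 => s h1.
  by rewrite /= /upd /= h1; case: sat.
- case/andP=> sc1 sc2 hst; have [h1 h2] := IH1 _ _ _ sc1 hst.
  rewrite [compile _ _]/= exec_Seq exec_If h1.
  have -> : sat d e (FAnd f1 f2) = sat d e f1 && sat d e f2 by [].
  case: (sat d e f1) h1 => h1; last by [].
  rewrite (_ : (nat_of_bool true == 0) = false) // andTb.
  set s := exec _ st in h1 h2 *.
  have hs : represents d e s.
    apply: represents_frame hst => // r sr; rewrite /s exec_frame //.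
    by apply: contra sr; apply: writes_compile.
  have [h3 h4] := IH2 _ _ _ sc2 hs; split=> //; exact: same_ram_trans h2 h4.
- move=> sc hst; have [st0 st2 stv sta] := hst.
  rewrite [compile _ _]/= !exec_Seq.
  set s1 := exec (Prim (IConst (aux1 d) 0)) st.
  have fr1 r : r != aux1 d -> s1.1 r = st.1 r by move=> ra; rewrite /s1 exec_frame.
  set c := (X in For _ X).
  have wl : well_formed (For (var d) c).
    by case/and3P: (well_formed_compile d (FEx f)) => _ _ /and3P[_ ].
  have wr r : writes (For (var d) c) r -> scratch d r.
    move=> h; apply: (@writes_compile d (FEx f)); apply/orP; right.
    by apply/orP; left.
  (* Rounds with [k >= n] change nothing, and at [k = L] the bound on [idx v] holds for every
     vertex. *)
  pose I k s := s.1 (aux1 d) = [exists v, (idx v < k) && sat d.+1 (bind e d v) f] :> nat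
    /\ same_ram d st s.
  have [||k s ks sk fr [h1 h2]|] := @for_rule _ _ s1 I wl.
  + move=> k s s' e1 e2; rewrite /I /same_ram -e2 -e1 //; rewrite /aux1 /var; lia.
  + split=> //; rewrite [RHS](_ : _ = 0); first by rewrite /s1 /= /upd eqxx.
    by case: existsP => // -[].
  + have fr' r : ~~ scratch d r -> s.1 r = st.1 r.
      move=> sr; rewrite fr; last by apply: contra sr; apply: wr.
      by rewrite fr1 //; move: sr; rewrite /scratch /aux1; lia.
    have hs : represents d e s by apply: represents_frame hst.
    have [s0 s2 _ _] := hs.
    rewrite /c exec_Seq exec_If; set s3 := exec (Prim (ISub 4 2 (var d))) s.
    have e34 : s3.1 4 = n - k by rewrite /s3 /= /upd /= s2 sk.
    have e3 r : r != 4 -> s3.1 r = s.1 r by move=> ra; rewrite /s3 exec_frame.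
    rewrite e34; case: eqP => [nk|kn].
      split=> //; rewrite e3 ?h1; last by rewrite /aux1; lia.
      congr nat_of_bool; apply: eq_existsb => v; congr (_ && _).
      by have := idx_lt v; lia.
    have [v hv] : exists v, idx v = k by apply: idx_surj; lia.
    have exS : [exists v, (idx v < k.+1) && sat d.+1 (bind e d v) f] =
        sat d.+1 (bind e d v) f || [exists v, (idx v < k) && sat d.+1 (bind e d v) f].
      apply/existsP/orP => [[w]|[h|/existsP[w /andP[wk h]]]].
      * rewrite ltnS leq_eqVlt -hv idx_eq => /andP[/orP[/eqP->|wk] h]; first by left.
        by right; apply/existsP; exists w; rewrite wk.
      * by exists v; rewrite hv ltnSn.
      * by exists w; rewrite ltnW.
    have rep3 : represents d.+1 (bind e d v) s3.
      apply: represents_bind; last by rewrite e3 ?sk // /var; lia.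
      apply: represents_frame hs => // r sr; apply: e3; move: sr; rewrite /scratch; lia.
    have [h3 h4] := IH _ _ _ sc rep3.
    rewrite exec_Seq exec_If h3; set s4 := exec _ s3 in h3 h4 *.
    have e4 : s4.1 (aux1 d) = s.1 (aux1 d).
      rewrite /s4 exec_frame ?e3 //; first by rewrite /aux1; lia.
      by apply/negP => /writes_compile; rewrite /scratch /aux1; lia.
    have sr4 : same_ram d st s4.
      by apply: same_ram_trans h2 _; apply: same_ramW.
    rewrite /I exS; case: (sat d.+1 (bind e d v) f) => /=.
      by split=> //; rewrite /upd eqxx.
    by split=> //; rewrite e4.
  + have s10 : s1.1 0 = L by rewrite fr1 // /aux1; lia.
    rewrite s10; move: (exec (For _ _) s1) => s [h1 h2]; split=> //.
    rewrite /= /upd /= ifN ?h1 /aux1; last lia.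
    congr nat_of_bool; apply: eq_existsb => v.
    by rewrite (leq_trans (idx_lt v) n_le).
- case/and3P=> id jd sc hst; apply: exec_reach => // v s; exact: IH.
Qed.

End Compile.

(** * Deciding formulas in polynomial time *)

(** Register 4 drops to 0 at the separator and stays there, so that the ones of the adjacency matrix
    are not counted. *)
Definition count_step :=
  Prim (IRead 5 6) ;; Prim (IConst 3 1) ;; Prim (ISub 3 3 5) ;;
  If 3 (Prim (IConst 4 0)) ;; Prim (IAdd 2 2 4).

Definition count_cmd :=
  Prim (IConst 2 0) ;; Prim (IConst 4 1) ;; For 6 count_step.

Lemma exec_count_cmd (st : store) n : n < st.1 0 ->
  (forall i, i <= n -> st.2 i = (i < n) :> nat) ->
  (exec count_cmd st).1 2 = n /\ (exec count_cmd st).2 = st.2.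
Proof.
move=> nL hn; rewrite /count_cmd !exec_Seq.
set s1 := exec (Prim _) (exec (Prim _) _).
pose I k s := [/\ s.1 4 = (k <= n) :> nat, s.1 2 = minn k n & s.2 = st.2].
have [||k s ks s6 fr [h4 h2 hm]|] := @for_rule 6 count_step s1 I isT.
- by move=> k s s' e1 e2 [h4 h2 hm]; split; rewrite -?e1 -?e2.
- by split; rewrite /s1 /= /upd /= ?min0n.
- have E : (exec count_step s).1 4 = (if s.2 k == 0 then 0 else s.1 4) /\
      (exec count_step s).1 2 = s.1 2 + (if s.2 k == 0 then 0 else s.1 4).
    have r3 : 1 - s.2 k == 0 = (s.2 k != 0) by lia.
    rewrite /count_step !exec_Seq exec_If.
    rewrite (_ : _.1 3 = 1 - s.2 k); last by rewrite /= /upd /= s6.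
    by rewrite r3; case: (s.2 k == 0); rewrite /= /upd.
  have Em : (exec count_step s).2 = s.2.
    by rewrite /count_step !exec_Seq exec_If; case: ifP.
  have E2 : (if st.2 k == 0 then 0 else nat_of_bool (k <= n)) = (k < n).
    by rewrite leqNgt; case: (ltnP n k) => kn; rewrite ?if_same ?hn //;
      [lia | case: (k < n)].
  by rewrite /I Em (proj1 E) (proj2 E) h4 h2 hm E2; split=> //; lia.
- by move=> _ -> ->; split=> //; apply/minn_idPr; rewrite ltnW.
Qed.

(** A graph without vertices has no valuation [nat -> G], so [represents] cannot hold and this case
    is run separately. *)
Lemma exec_compile_FEx_empty f (st : store) : st.1 2 = 0 ->
  (exec (compile 0 (FEx f)) st).1 3 = 0.
Proof.
move=> st2; rewrite [compile _ _]/= !exec_Seq.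
set s1 := exec _ st; set c := (X in For _ X).
have wl : well_formed (For (var 0) c).
  by case/and3P: (well_formed_compile 0 (FEx f)) => _ _ /and3P[_ ].
have h : (exec (For (var 0) c) s1).1 (aux1 0) = 0.
  apply: (@for_rule _ _ s1 (fun _ s => s.1 (aux1 0) = 0) wl) => //.
    by move=> k s s' e1 _; rewrite -e1.
  move=> k s ks sk fr h.
  have s2 : s.1 2 = 0.
    rewrite fr //; apply/negP => /or3P[//|//|].
    by case/orP=> // /orP[/writes_compile|].
  by rewrite /c exec_Seq exec_If /= /upd /= s2.
by rewrite -[RHS]h.
Qed.

Lemma size_graph_encoding (G : sgraph) (s : seq G) :
  size (nseq (size s) true ++ false :: [seq x -- y | x <- s, y <- s]) =
    (size s).+1 + size s * size s.
Proof. by rewrite size_cat size_nseq /= size_allpairs addnS. Qed.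

Lemma nth_allpairs (S T R : Type) (f : S -> T -> R) s t x0 y0 z0 i j :
  i < size s -> j < size t ->
  nth z0 [seq f x y | x <- s, y <- t] (i * size t + j) = f (nth x0 s i) (nth y0 t j).
Proof.
elim: s i => // x s IH [|i] /=; rewrite nth_cat size_map => hi hj.
  by rewrite hj (nth_map y0).
by rewrite mulSn -addnA ltnNge leq_addr /= addKn IH.
Qed.

(** On the empty graph the equivalence with [sat] is vacuous; there the program answers no, and the
    second hypothesis makes this correct. The polynomial comes from the command, hence from [f]
    alone. *)
Theorem polynomial_time_formula f (Q : sgraph -> Prop) :
  scoped 1 f -> (forall G : sgraph, Q G -> exists x : G, true) ->
  (forall (G : sgraph) (e : nat -> G), sat 0 e (FEx f) <-> Q G) ->
  polynomial_time graph_encoding Q.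
Proof.
move=> sc Qne Qsat.
pose c := count_cmd ;; compile 0 (FEx f) ;; Prim (IConst 4 0) ;; Prim (IAdd 0 3 4).
have [K [D cK]] := cost_poly c.
exists (code c 0), K, D => G w [s [us sT ->]].
set w' := _ ++ _; rewrite /decides_within.
pose st : store := (reg (init w'), ram (init w')).
have wc : well_formed c.
  apply/and3P; split=> //; apply/and3P; split=> //.
    by apply/negP => /(@writes_compile 0 (FEx f)).
  exact: (well_formed_compile 0 (FEx f)).
have [|t ht et] := @code_correct c [::] [::] (code c 0) st wc.
  by rewrite cats0.
have L0 : st.1 0 = size w' by [].
rewrite L0 in ht.
(* The machine halts after at most [t] steps and then stays where it is until the prescribed
   time. *)
have fin : iter (K * size w' ^ D + K) (step (code c 0)) (init w') =
    Config (csize c) (exec c st).1 (exec c st).2.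
  rewrite -(subnK (leq_trans ht (cK _))) iterD.
  have -> : init w' = Config 0 st.1 st.2 by [].
  rewrite et add0n; elim: (_ - _) => // k IH; rewrite iterS IH.
  have o : onth (code c 0) (csize c) = None by apply: onth_default; rewrite size_code.
  by rewrite /step [pc _]/= o.
rewrite fin /halted size_code; split; first exact: leqnn.
pose n := size s.
have sw : size w' = n.+1 + n * n by apply: size_graph_encoding.
have [||c2 cm] := @exec_count_cmd st n; first by rewrite L0 sw; lia.
  move=> i; rewrite leq_eqVlt /= nth_cat size_nseq -/n => /orP[/eqP->|lin].
    by rewrite ltnn subnn.
  by rewrite lin nth_nseq lin.
set s1 := exec count_cmd st in c2 cm.
have cE : (exec c st).1 0 = (exec (compile 0 (FEx f)) s1).1 3.
  have addE s' : (exec (Prim (IAdd 0 3 4)) (exec (Prim (IConst 4 0)) s')).1 0 = s'.1 3.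
    by rewrite /= /upd /= addn0.
  by rewrite /c !exec_Seq addE.
rewrite [reg _ 0]cE.
have [x0|noG] := pickP G; last first.
  have n0 : n = 0 by rewrite /n; case: (s) => // x; have := noG x.
  rewrite exec_compile_FEx_empty ?c2 //; split=> // /Qne[x _].
  by have := noG x.
have rep : @represents G s (size w') 0 (fun=> x0) s1.
  split=> [|//|//|x y]; first by rewrite /s1 exec_frame.
  have ix z : index z s < n by rewrite index_mem sT.
  rewrite cm /= nth_cat size_nseq ltnNge -/n.
  rewrite (_ : n <= _) /=; last by lia.
  rewrite (_ : _ + _ - n = (index x s * n + index y s).+1) /=; last by lia.
  by rewrite (@nth_allpairs _ _ _ _ _ _ x y) ?nth_index.
have [|-> _] := @compile_correct G s (size w') us sT _ 0 (FEx f) (fun=> x0) s1 sc rep.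
  by rewrite sw.
by rewrite -(Qsat G (fun=> x0)) -lt0n lt0b.
Qed.

(** * Triangles with hanging paths *)

(** The common shape of houses and bulls: off the triangle only local data matter, namely a
    neighbour [p] of smaller weight and at most one other neighbour. Where there is no other, [k] is
    a dummy. *)
Record hanging_triangle (H : sgraph) (a u v b c : H) (wt : H -> nat) : Prop := {
  ht_uniq : uniq [:: a; u; v; b; c];
  ht_a : forall k, a -- k = (k \in [:: u; v]);
  ht_u : forall k, u -- k = (k \in [:: a; v; b]);
  ht_v : forall k, v -- k = (k \in [:: a; u; c]);
  ht_tail : forall h, h \notin [:: a; u; v] -> exists p k,
    [/\ wt p < wt h, h -- p & forall l, h -- l -> l = p \/ l = k] }.

Section HangingTriangle.
Variables (H : sgraph) (a u v b c : H) (wt : H -> nat).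
Hypothesis ht : hanging_triangle a u v b c wt.

Definition tail := [seq h <- enum H | h \notin [:: a; u; v]].

Lemma mem_tail h : (h \in tail) = (h \notin [:: a; u; v]).
Proof. by rewrite mem_filter mem_enum andbT. Qed.

Lemma triangle_neq : [/\ a != u, a != v & u != v] /\ [/\ b \in tail, c \in tail & b != c].
Proof.
have := ht_uniq ht; rewrite !mem_tail /= !inE ![b == _]eq_sym ![c == _]eq_sym.
by do !case: eqP => //=.
Qed.

Section Embedding.
Variable (G : sgraph).
Implicit Types q : H -> G.

Definition embeds q := [forall h in tail, forall k in tail, (h != k) ==>
  (q h != q k) && ((q h -- q k) == (h -- k))].

(** The options [Some b], [Some c] and [None] yield the sets [S], [T] and [F]. A vertex with any
    other adjacency to the images of the tail can join no branch set of the triangle. *)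
Definition sees q (o : option H) :=
  [set w | [forall h in tail, (w != q h) && ((w -- q h) == (Some h == o))]].

Lemma sees_disjoint q o o' h : h \in tail -> (Some h == o) != (Some h == o') ->
  [disjoint sees q o & sees q o'].
Proof.
move=> hT oo'; apply/disjointP => w; rewrite !inE => /forall_inP/(_ _ hT)/andP[_ /eqP e].
by move/forall_inP/(_ _ hT)/andP => [_]; rewrite e (negPf oo').
Qed.

Lemma sees_ext q q' o : {in tail, q =1 q'} -> sees q o = sees q' o.
Proof.
move=> e; apply/setP => w; rewrite !inE; apply: eq_forallb => h.
by case hT: (h \in tail) => //=; rewrite e.
Qed.

Lemma embeds_ext q q' : {in tail, q =1 q'} -> embeds q = embeds q'.
Proof.
move=> e; apply: eq_forallb => h; case hT: (h \in tail) => //=.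
by apply: eq_forallb => k; case kT: (k \in tail) => //=; rewrite !e.
Qed.

Notation Sq q := (sees q (Some b)).
Notation Tq q := (sees q (Some c)).
Notation Fq q := (sees q None).

Lemma sees_disjoints q :
  [disjoint Sq q & Tq q] /\ [disjoint Tq q & Fq q].
Proof.
have [_ [bT cT bc]] := triangle_neq.
split; [apply: (sees_disjoint q bT)|apply: (sees_disjoint q cT)]; rewrite eqxx //.

Qed.

(** An edge from [B k] to a singleton is an edge of [H] at [k]. Off the triangle [u] has only the
    neighbour [b], [v] only [c], and [a] none, which places [B u], [B v] and [B a]. *)
Lemma model_linkage (B : H -> {set G}) q :
  minor_model B -> (forall h, h \in tail -> B h = [set q h]) ->
  embeds q /\ linkage (Sq q) (Tq q) (Fq q) (B u) (B v) (B a).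
Proof.
move=> [cB dB tB] Bq; have [[au av uv] [bT cT bc]] := triangle_neq.
have qB h : h \in tail -> q h \in B h by move=> hT; rewrite Bq // set11.
have dis h k : h != k -> [disjoint B h & B k].
  by move=> hk; apply/disjointP => x xh xk; rewrite (dB _ _ _ xh xk) eqxx in hk.
have core h k : k \notin tail -> h \in tail -> k != h by move=> kT hT; apply: contraNneq kT => ->.
have seesB k w h : k \notin tail -> w \in B k -> h \in tail ->
    (w != q h) /\ (w -- q h -> k -- h).
  move=> kT wB hT; have kh := core _ _ kT hT; split.
    by apply: contraNneq kh => e; apply/eqP; apply: (dB _ _ w) => //; rewrite e qB.
  by move=> wq; rewrite tB //; apply/touchP; exists w, (q h); rewrite qB.
have sub k x w : k \notin tail -> w \in B k -> (forall h, h \in tail -> k -- h -> h = x) ->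
    w \in sees q (Some x) :|: sees q None.
  move=> kT wB kx; rewrite !inE -implyNb; apply/implyP => /forall_inPn[h hT].
  have [-> /= wx] := seesB _ _ _ kT wB hT => nwx.
  have : ~~ [forall h in tail, (w != q h) && ((w -- q h) == (Some h == None))] ->
     exists2 h, h \in tail & w -- q h.
    case/forall_inPn=> k' k'T; have [-> _] := seesB _ _ _ kT wB k'T.
    by rewrite /= eqbF_neg negbK; exists k'.
  move=> ex; apply/negPn/negP => /ex[k' k'T wk']; move/negP: nwx; apply.
  have k'x := kx _ k'T (proj2 (seesB _ _ _ kT wB k'T) wk').
  apply/eqP; apply/idP/eqP => [wh|[hx]]; first by congr Some; apply: kx => //; apply: wx.
  by rewrite hx -k'x.
have Nu : u \notin tail by rewrite mem_tail !inE eqxx orbT.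
have Nv : v \notin tail by rewrite mem_tail !inE eqxx !orbT.
have Na : a \notin tail by rewrite mem_tail !inE eqxx.
have tN h : h \in tail -> [/\ h != a, h != u & h != v].
  by rewrite mem_tail !inE => /norP[? /norP[? ?]].
have ub h : h \in tail -> u -- h -> h = b.
  by case/tN => /negPf ha _ /negPf hv; rewrite (ht_u ht) !inE ha hv => /eqP.
have vc h : h \in tail -> v -- h -> h = c.
  by case/tN => /negPf ha /negPf hu _; rewrite (ht_v ht) !inE ha hu => /eqP.
have meet k x : k \notin tail -> x \in tail -> k -- x -> (forall h, h \in tail -> k -- h -> h = x) ->
    exists2 w, w \in B k & w \in sees q (Some x).
  move=> kT xT kx' kx; have := kx'; rewrite tB ?core // (Bq x) // => /touchP[w [_ [wB /set1P-> wx]]].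
  exists w => //; have := sub _ x _ kT wB kx; rewrite in_setU => /orP[//|].
  by rewrite inE => /forall_inP/(_ _ xT)/andP[_]; rewrite wx.
split.
  apply/forall_inP => h hT; apply/forall_inP => k kT; apply/implyP => hk.
  have -> : h -- k = q h -- q k by rewrite tB // !Bq // touch11.
  rewrite eqxx andbT; apply: contraNneq hk => e; apply/eqP.
  by apply: (dB _ _ (q h)); rewrite ?qB // e qB.
split=> //; try by apply: dis; rewrite // eq_sym.
- by apply/subsetP => w wB; apply: sub wB ub.
- by apply/subsetP => w wB; apply: sub wB vc.
- apply/subsetP => w wB; rewrite inE; apply/forall_inP => h hT.
  have [-> wh] := seesB _ _ _ Na wB hT; rewrite eqbF_neg; apply/negP => /wh.
  by rewrite (ht_a ht) !inE; case: (tN _ hT) => _ /negPf-> /negPf->.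
- by apply: meet ub => //; rewrite (ht_u ht) !inE eqxx !orbT.
- by apply: meet vc => //; rewrite (ht_v ht) !inE eqxx !orbT.
- by rewrite -tB // (ht_u ht) !inE eqxx orbT.
- by rewrite -tB 1?eq_sym // (ht_u ht) !inE eqxx.
- by rewrite -tB 1?eq_sym // (ht_v ht) !inE eqxx.
Qed.

Lemma linkage_model q U V A :
  embeds q -> linkage (Sq q) (Tq q) (Fq q) U V A ->
  exists B : H -> {set G}, minor_model B.
Proof.
move=> emb [cU cV cA sU sV sA dUV dUA dVA [s sU' sS] [t tV tT] tUV tUA tVA].
have [[au av uv] [bT cT bc]] := triangle_neq.
pose B h := if h == a then A else if h == u then U else if h == v then V else [set q h].
have Ba : B a = A by rewrite /B eqxx.
have Bu : B u = U by rewrite /B eq_sym (negPf au) eqxx.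
have Bv : B v = V by rewrite /B ![v == _]eq_sym (negPf av) (negPf uv) eqxx.
have tN h : h \in tail -> [/\ h != a, h != u & h != v].
  by rewrite mem_tail !inE => /norP[? /norP[? ?]].
have Bq h : h \in tail -> B h = [set q h].
  by case/tN => /negPf ha /negPf hu /negPf hv; rewrite /B ha hu hv.
have cases h : [\/ h = a, h = u, h = v | h \in tail].
  rewrite mem_tail !inE; case: (eqVneq h a); first by constructor 1.
  case: (eqVneq h u); first by constructor 2.
  by case: (eqVneq h v); [constructor 3|constructor 4].
have seesN o w h : h \in tail -> w \in sees q o -> w != q h /\ (w -- q h) = (Some h == o).
  by move=> hT; rewrite inE => /forall_inP/(_ _ hT)/andP[-> /eqP].
have subN (X : {set G}) x w h : h \in tail -> X \subset sees q (Some x) :|: Fq q -> w \in X ->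
    w != q h /\ (w -- q h -> h = x).
  move=> hT sX wX; case/setUP: (subsetP sX _ wX) => /(seesN _ _ _ hT)[-> ->]; split=> //.
  by move/eqP=> [].
have tch (X : {set G}) x h : h \in tail -> X \subset sees q (Some x) :|: Fq q ->
    (exists2 w, w \in X & w \in sees q (Some x)) -> touch X [set q h] = (h == x).
  move=> hT sX [w wX wS]; apply/touchP/eqP => [[w' [_ [w'X /set1P->]]]|hx].
    by have [_] := subN _ _ _ _ hT sX w'X.
  by exists w, (q h); rewrite set11 (proj2 (seesN _ _ _ hT wS)) hx.
have disq h k x : h \in tail -> k \notin tail -> x \in B k -> x != q h.
  move=> hT; case: (cases k) => [->|->|->|-> //] _.
  - by rewrite Ba => /(subsetP sA)/(seesN _ _ _ hT)[].
  - by rewrite Bu => xU; case: (subN _ _ _ _ hT sU xU).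
  - by rewrite Bv => xV; case: (subN _ _ _ _ hT sV xV).
have tA h : h \in tail -> touch A [set q h] = false.
  move=> hT; apply/touchP => -[w [_ [wA /set1P->]]].
  by rewrite (proj2 (seesN _ _ _ hT (subsetP sA _ wA))).
have embE h k : h \in tail -> k \in tail -> h != k -> q h != q k /\ (q h -- q k) = (h -- k).
  move=> hT kT hk; move/forall_inP: emb => /(_ _ hT)/forall_inP/(_ _ kT).
  by rewrite hk => /andP[-> /eqP].
exists B; split.
- move=> h; case: (cases h) => [->|->|->|hT]; rewrite ?Ba ?Bu ?Bv //.
  by rewrite Bq //; apply: connected1.
- suff dis h k : h != k -> [disjoint B h & B k].
    move=> h k x xh xk; apply/eqP; apply/negPn/negP => /dis/disjointP; apply; [exact: xh|exact: xk].
  have [kT|kT] := boolP (k \in tail); have [hT|hT] := boolP (h \in tail).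
  + move=> hk; rewrite !Bq //; apply/disjointP => x /set1P-> /set1P e.
    by case: (embE _ _ hT kT hk); rewrite e eqxx.
  + move=> _; rewrite (Bq k) //; apply/disjointP => x xh /set1P e.
    by have := disq _ _ _ kT hT xh; rewrite e eqxx.
  + move=> _; rewrite (Bq h) //; apply/disjointP => x /set1P e xk.
    by have := disq _ _ _ hT kT xk; rewrite e eqxx.
  + case: (cases h) hT => [->|->|->|-> //] _; case: (cases k) kT => [->|->|->|-> //] _;
    by rewrite ?Ba ?Bu ?Bv ?eqxx // disjoint_sym.
- have na h : h \in tail -> a -- h = touch A [set q h].
    by move=> hT; rewrite tA // (ht_a ht) !inE; case: (tN _ hT) => _ /negPf-> /negPf->.
  have nu h : h \in tail -> u -- h = touch U [set q h].
    move=> hT; rewrite (tch _ b) //; last by exists s.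
    by rewrite (ht_u ht) !inE; case: (tN _ hT) => /negPf-> _ /negPf->.
  have nv h : h \in tail -> v -- h = touch V [set q h].
    move=> hT; rewrite (tch _ c) //; last by exists t.
    by rewrite (ht_v ht) !inE; case: (tN _ hT) => /negPf-> /negPf-> _.
  have uv' : u -- v by rewrite (ht_u ht) !inE eqxx orbT.
  have ua' : u -- a by rewrite (ht_u ht) !inE eqxx.
  have va' : v -- a by rewrite (ht_v ht) !inE eqxx.
  move=> h k; case: (cases h) => [->|->|->|hT]; case: (cases k) => [->|->|->|kT];
    rewrite ?eqxx // ?Ba ?Bu ?Bv ?(Bq k) ?(Bq h) //.
  + by rewrite sedge_sym ua' touch_sym tUA.
  + by rewrite sedge_sym va' touch_sym tVA.
  + by rewrite na.
  + by rewrite ua' tUA.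
  + by rewrite uv' tUV.
  + by rewrite nu.
  + by rewrite va' tVA.
  + by rewrite sedge_sym uv' touch_sym tUV.
  + by rewrite nv.
  + by rewrite sedge_sym na // touch_sym.
  + by rewrite sedge_sym nu // touch_sym.
  + by rewrite sedge_sym nv // touch_sym.
  + by move=> hk; rewrite touch11; case: (embE _ _ hT kT hk).
Qed.

Lemma minor_certificate :
  induced_minor H G <-> exists q x0 x t s y u1 v1,
    embeds q /\ certificate (Sq q) (Tq q) (Fq q) x0 x t s y u1 v1.
Proof.
split=> [/minor_model_of_minor[B0 mB0]|[q [x0 [x [t [s [y [u1 [v1 [emb cert]]]]]]]]]].
  have [|B mB Bs] := @minor_model_singletons H G (mem [:: a; u; v]) wt B0 _ mB0.
    exact: ht_tail ht.
  (* The map [q] has to be total; on the triangle any vertex of the branch set serves as its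
     value. *)
  have Bs' h : exists x, (h \in tail) ==> (B h == [set x]).
    have [hT|hT] := boolP (h \in tail).
      by have [x ->] := Bs h (etrans (esym (mem_tail h)) hT); exists x; rewrite eqxx.
    by case: mB => cB _ _; have [/set0Pn[x _] _] := cB h; exists x.
  pose q h := xchoose (Bs' h).
  have qE h : h \in tail -> B h = [set q h].
    by move=> hT; apply/eqP; have /implyP := xchooseP (Bs' h); apply.
  have [emb lk] := model_linkage mB qE.
  have [d1 d3] := sees_disjoints q.
  have [x0 [x [t [s [y [u1 [v1 cert]]]]]]] := linkage_certificate d1 lk.
  by exists q, x0, x, t, s, y, u1, v1.
have [d1 d3] := sees_disjoints q.
have [B mB] := linkage_model emb (certificate_linkage d1 d3 cert).
exact: (minor_of_minor_model a mB).
Qed.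

End Embedding.
End HangingTriangle.

(** [FReach] tests only the targets of steps. This amounts to staying inside [D] because the start
    is assumed to lie in [D]. *)
Lemma component_reach (G : sgraph) (D : {set G}) x y : x \in D ->
  (y \in component D x) = connect (fun v w => v -- w && (w \in D)) x y.
Proof.
move=> xD; rewrite inE; apply/idP/idP => [|xy].
  by apply: connect_sub => v w /and3P[vw _ wD]; apply: connect1; rewrite vw.
rewrite -[X in is_true X]/((fun z => connect (within D) x z) y).
pose P z := (z \in D) && connect (within D) x z.
suff /andP[] : P y by [].
apply: (connect_ind _ _ xy) => [v w /andP[vD xv] /andP[vw wD]|]; last by rewrite /P xD connect0.
by rewrite /P wD; apply: connect_trans xv (connect1 _); rewrite withinE vw vD.
Qed.

(** * Containment of H as a formula with reachability *)

Definition FTrue := FEq 0 0.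
Definition FAll := foldr FAnd FTrue.
Definition FOr f g := FNot (FAnd (FNot f) (FNot g)).
Definition FIff (b : bool) f := if b then f else FNot f.

Lemma sat_FAll (G : sgraph) d (e : nat -> G) fs : sat d e (FAll fs) = all (sat d e) fs.
Proof. by elim: fs => //= [|f fs ->] //; rewrite eqxx. Qed.

Lemma sat_FOr (G : sgraph) d (e : nat -> G) f g : sat d e (FOr f g) = sat d e f || sat d e g.
Proof. by rewrite /= -negb_or negbK. Qed.

Lemma sat_FIff (G : sgraph) d (e : nat -> G) b f : sat d e (FIff b f) = (sat d e f == b).
Proof. by case: b; rewrite /= ?eqb_id ?eqbF_neg. Qed.

Lemma satE (G : sgraph) d (e : nat -> G) :
  (forall f g, sat d e (FAnd f g) = sat d e f && sat d e g) *
  (forall f, sat d e (FNot f) = ~~ sat d e f) *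
  (forall i j, sat d e (FEq i j) = (e i == e j)) *
  (forall i j, sat d e (FEdge i j) = (e i -- e j)).
Proof. by []. Qed.

Lemma sat_FReach (G : sgraph) d (e : nat -> G) f i j : sat d e (FReach f i j) =
  connect (fun v w => v -- w && sat d.+1 (bind e d w) f) (e i) (e j).
Proof. by []. Qed.

Lemma scopedE d :
  (forall f g, scoped d (FAnd f g) = scoped d f && scoped d g) *
  (forall f g, scoped d (FOr f g) = scoped d f && scoped d g) *
  (forall f, scoped d (FNot f) = scoped d f) *
  (forall i j, scoped d (FEq i j) = (i < d) && (j < d)) *
  (forall i j, scoped d (FEdge i j) = (i < d) && (j < d)) *
  (forall f i j, scoped d (FReach f i j) = [&& i < d, j < d & scoped d.+1 f]).
Proof. by []. Qed.

Lemma scoped_FAnd d f g : scoped d f -> scoped d g -> scoped d (FAnd f g).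
Proof. by move=> sf sg; rewrite /= sf. Qed.

Lemma scoped_FAll d fs : 0 < d -> scoped d (FAll fs) = all (scoped d) fs.
Proof. by move=> d0; elim: fs => //= [|f fs ->] //; rewrite d0. Qed.

Local Arguments sat : simpl never.
Local Arguments scoped : simpl never.

Section MinorFormula.
Variables (H : sgraph) (a u v b c : H).

Notation R := (tail a u v).
Let m := size R.

Definition tail_var h := index h R.

(** As [H] is fixed, its adjacency is resolved while the formula is built: [FIff] selects the atom
    or its negation. The variables below [m] stand for the images of the tail. *)
Definition f_embeds := FAll [seq
  if h == k then FTrue else
  FAnd (FNot (FEq (tail_var h) (tail_var k))) (FIff (h -- k) (FEdge (tail_var h) (tail_var k)))
  | h <- R, k <- R].

Definition f_sees o y := FAll [seq
  FAnd (FNot (FEq y (tail_var h))) (FIff (Some h == o) (FEdge y (tail_var h))) | h <- R].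

(** The parameter [d] is the depth at which the formula stands, hence also the variable bound by its
    [FReach]. It varies because [f_near] uses [f_far] one level deeper, applied to its own bound
    variable. *)
Definition f_far d z :=
  FReach (FAnd (FOr (f_sees (Some c) d) (f_sees None d))
               (FAnd (FNot (FEq d m)) (FNot (FEq d m.+1)))) m.+2 z.

Definition f_near d z :=
  FReach (FAnd (FOr (f_sees (Some b) d) (f_sees None d))
               (FAnd (FNot (FEq d m)) (FNot (f_far d.+1 d)))) m.+1 z.

(* The variables m, ..., m + 6 stand for a, x, t, s, v, u1, v1. *)
Definition f_certificate :=
  let d := m.+4.+3 in
  FAnd (FAll [:: f_sees None m; FOr (f_sees (Some b) m.+1) (f_sees None m.+1);
                 f_sees (Some c) m.+2; f_sees (Some b) m.+3; FEdge m m.+1])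
       (FAll [:: f_near d m.+3; f_far d m.+4; FEdge m m.+4;
                 f_near d m.+4.+1; f_far d m.+4.+2; FEdge m.+4.+1 m.+4.+2]).

Definition f_minor := FAnd f_embeds f_certificate.

Lemma tail_var_lt h : h \in R -> tail_var h < m.
Proof. by rewrite /tail_var index_mem. Qed.

Lemma scoped_sees d o y : m <= d -> y < d -> scoped d (f_sees o y).
Proof.
move=> md yd; rewrite scoped_FAll ?(leq_ltn_trans _ yd) // all_map; apply/allP => h hR /=.
have hd : tail_var h < d by apply: leq_trans md; apply: tail_var_lt.
by rewrite /FIff; case: ifP => _; rewrite !scopedE yd hd.
Qed.

Lemma scoped_minor : scoped m.+4.+3 f_minor.
Proof.
have far d z : m.+2 < d -> z < d -> scoped d (f_far d z).
  by move=> md zd; rewrite /f_far !scopedE !scoped_sees; lia.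
have near d z : m.+2 < d -> z < d -> scoped d (f_near d z).
  by move=> md zd; rewrite /f_near /f_far !scopedE !scoped_sees; lia.
apply: scoped_FAnd; last first.
  apply: scoped_FAnd; rewrite scoped_FAll // /all ?far ?near ?scopedE ?scoped_sees; lia.
rewrite scoped_FAll //.
apply/all_allpairsP => h k hR kR.
case: ifP => _ //; have := tail_var_lt hR; have := tail_var_lt kR.
by rewrite /FIff; case: ifP => _; rewrite !scopedE; lia.
Qed.

Section Sat.
Variables (G : sgraph) (d : nat) (e : nat -> G).
Hypothesis md : m.+4.+3 <= d.

Let q h := e (tail_var h).
Let S := sees a u v q (Some b).
Let T := sees a u v q (Some c).
Let F := sees a u v q None.

Lemma sat_embeds : sat d e f_embeds = embeds a u v q.
Proof.
rewrite sat_FAll; apply/all_allpairsP/forall_inP => [h1 h hR|h1 h k hR kR].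
  apply/forall_inP => k kR; apply/implyP => hk.
  by have := h1 _ _ hR kR; rewrite (negPf hk) !satE sat_FIff satE.
case: ifP => [_|hk]; first by rewrite satE.
by have /forall_inP/(_ _ kR) := h1 _ hR; rewrite hk !satE sat_FIff satE.
Qed.

Lemma sat_sees d' e' o y : (forall i, i < m -> e' i = e i) ->
  sat d' e' (f_sees o y) = (e' y \in sees a u v q o).
Proof.
move=> ee; rewrite sat_FAll all_map inE; apply/allP/forall_inP => h1 h hR;
  have := h1 _ hR; rewrite /= !satE sat_FIff satE (ee (tail_var h)) //;
  exact: tail_var_lt.
Qed.

Lemma sat_far d' e' z : m.+4.+3 <= d' -> (forall i, i < m.+4.+3 -> e' i = e i) ->
  e m.+2 \in (T :|: F) :\: [set e m; e m.+1] ->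
  sat d' e' (f_far d' z) = (e' z \in far_side T F (e m) (e m.+1) (e m.+2)).
Proof.
move=> md' ee tD; rewrite component_reach // /f_far sat_FReach ee; last by lia.
apply: eq_connect => x y; congr (_ && _).
have be i : i < m.+4.+3 -> bind e' d' y i = e i.
  by move=> im; rewrite /bind ifN ?ee //; apply/eqP; lia.
rewrite satE sat_FOr !satE !sat_sees; try by move=> i im; apply: be; lia.
rewrite (be m) ?(be m.+1); try lia.
by rewrite /bind eqxx in_setD in_set2 in_setU negb_or andbC.
Qed.

Lemma sat_near z :
  e m.+2 \in (T :|: F) :\: [set e m; e m.+1] ->
  e m.+1 \in (S :|: F) :\: (e m |: far_side T F (e m) (e m.+1) (e m.+2)) ->
  sat d e (f_near d z) = (e z \in near_side S T F (e m) (e m.+1) (e m.+2)).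
Proof.
move=> tD xD; rewrite component_reach // /f_near sat_FReach.
apply: eq_connect => x y; congr (_ && _).
have be i : i < m.+4.+3 -> bind e d y i = e i.
  by move=> im; rewrite /bind ifN //; apply/eqP; lia.
rewrite satE sat_FOr !satE (sat_far _ (leqW md) be tD) !sat_sees;
  try by move=> i im; apply: be; lia.
rewrite (be m); last by lia.
by rewrite /bind eqxx in_setD in_setU1 in_setU negb_or andbC.
Qed.

(** The reachability formulas describe components only if their starting points lie in the right
    sets. The first conjuncts guarantee this, so they are settled first and the others are compared
    only when these hold. *)
Lemma sat_certificate :
  m.+4.+3 = d -> [disjoint S & T] -> [disjoint T & F] ->
  sat d e f_certificate =
    certificate S T F (e m) (e m.+1) (e m.+2) (e m.+3) (e m.+4) (e m.+4.+1) (e m.+4.+2).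
Proof.
move=> dE ST TF; rewrite /f_certificate dE satE !sat_FAll /all sat_FOr !sat_sees // !satE !andbT.
rewrite /certificate in_setU.
case: (boolP (e m \in F)) => // aF.
case: (boolP ((e m.+1 \in S) || (e m.+1 \in F))) => // xSF.
case: (boolP (e m.+2 \in T)) => // tT.
case: (boolP (e m.+3 \in S)) => // sS.
case: (boolP (e m -- e m.+1)) => // ax.
have xSF' : e m.+1 \in S :|: F by rewrite in_setU.
have tD := mem_far_side_domain ST TF aF xSF' tT.
have xD : e m.+1 \in (S :|: F) :\: (e m |: far_side T F (e m) (e m.+1) (e m.+2)).
  rewrite in_setD xSF' andbT in_setU1 negb_or; apply/andP; split.
    by apply: contraTneq ax => ->; rewrite sedge_irr.
  by apply/negP => /(subsetP (component_sub tD)); rewrite !inE eqxx orbT.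
by rewrite /= !sat_near ?sat_far // !andbA.
Qed.

End Sat.
End MinorFormula.

Theorem hanging_triangle_polynomial (H : sgraph) (a u v b c : H) (wt : H -> nat) :
  hanging_triangle a u v b c wt ->
  polynomial_time graph_encoding (fun G => induced_minor H G).
Proof.
move=> ht; pose m := size (tail a u v).
pose f := f_minor a u v b c.
have scf : scoped m.+4.+3 f by apply: scoped_minor.
have [_ [bT cT bc]] := triangle_neq ht.
(* There are [m + 7] quantifiers; the outermost is supplied by the statement being applied. *)
apply: (@polynomial_time_formula (iter m.+4.+2 FEx f)).
- by rewrite scoped_iter_FEx add1n.
- move=> G /minor_model_of_minor[B [cB _ _]].
  by have [/set0Pn[x _] _] := cB a; exists x.
move=> G e0; rewrite -[FEx _]/(iter m.+4.+3 FEx f) (minor_certificate ht).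
have dis (e : nat -> G) := sees_disjoints ht (fun h => e (tail_var a u v h)).
split=> [/(@sat_iter_FEx _ _ 0 _ _ scf)[e _]|].
  rewrite add0n /f /f_minor satE sat_embeds //; case/andP=> emb.
  have [d1 d3] := dis e.
  by rewrite sat_certificate // => cert; do 8 eexists; split; [exact: emb|exact: cert].
case=> q [x0 [x [t [s [y [u1 [v1 [emb cert]]]]]]]].
pose e i := if i < m then q (nth a (tail a u v) i) else nth x0 [:: x0; x; t; s; y; u1; v1] (i - m).
have eq_q : {in tail a u v, q =1 fun h => e (tail_var a u v h)}.
  by move=> h hT; rewrite /e index_mem hT nth_index.
have em i : e (i + m) = nth x0 [:: x0; x; t; s; y; u1; v1] i.
  by rewrite /e ltnNge leq_addl /= addnK.
apply/(@sat_iter_FEx _ _ 0 _ _ scf); exists e => //.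
have [d1 d3] := dis e.
rewrite add0n /f /f_minor satE sat_embeds // sat_certificate //.
rewrite -(embeds_ext eq_q) -!(sees_ext _ eq_q) emb.
rewrite -/m (em 6) (em 5) (em 4) (em 3) (em 2) (em 1) (em 0).
exact: cert.
Qed.

(** * Generalized houses and bulls *)

Lemma mem_path_edges (T : eqType) (s : seq T) x y : uniq s ->
  ((x, y) \in path_edges s) = (y \in s) && (index y s == (index x s).+1).
Proof.
case: s => // z s; elim: s z => [|z' s IH] z.
  by rewrite /= !inE eq_sym => _; case: eqP.
rewrite cons_uniq => /andP[zs us].
rewrite -[path_edges _]/((z, z') :: path_edges (z' :: s)) [(x, y) \in _]in_cons IH // xpair_eqE.
have ixE w : index w [:: z, z' & s] = if z == w then 0 else (index w (z' :: s)).+1 by [].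
rewrite [y \in z :: _]in_cons !ixE [x == z]eq_sym [y == z]eq_sym.
have [<-|zy] := eqVneq z y.
  rewrite (negPf zs) andFb orbF andbC; apply/negP => /andP[/eqP e _].
  by move: zs; rewrite e mem_head.
have [<-|zx] := eqVneq z x; last by rewrite eqSS.
have -> : index z (z' :: s) = size (z' :: s) by apply/memNindex.
rewrite eqSS andTb orFb; case: (eqVneq y z') => [->|yz'].
  by rewrite mem_head [index z' _]/= eqxx.
have -> : (index y (z' :: s) == 0) = false by rewrite /= [z' == y]eq_sym (negPf yz').
rewrite andbF; apply/negP => /andP[]; rewrite -index_mem => ys /eqP e.
by rewrite e ltnNge leqnSn in ys.
Qed.

Section PathEdges.
Variables (T : eqType) (x0 : T) (s : seq T).
Hypothesis s_uniq : uniq s.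

Lemma path_edges_mem x y : (x, y) \in path_edges s -> x \in s /\ y \in s.
Proof.
rewrite mem_path_edges // => /andP[ys /eqP i]; split=> //.
by rewrite -index_mem; move: ys; rewrite -index_mem; apply: ltn_trans; rewrite i.
Qed.

Lemma path_edges_next x y : (x, y) \in path_edges s -> y = nth x0 s (index x s).+1.
Proof. by rewrite mem_path_edges // => /andP[ys /eqP<-]; rewrite nth_index. Qed.

Lemma path_edges_prev x y : (x, y) \in path_edges s -> x = nth x0 s (index y s).-1.
Proof.
move=> xy; have [xs _] := path_edges_mem xy.
by move: xy; rewrite mem_path_edges // => /andP[_ /eqP->]; rewrite nth_index.
Qed.

Lemma path_edges_nth i : i.+1 < size s -> (nth x0 s i, nth x0 s i.+1) \in path_edges s.
Proof.
move=> si; rewrite mem_path_edges // mem_nth // !index_uniq ?eqxx //.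
exact: ltnW.
Qed.

End PathEdges.

Section Core.
Variables (H : sgraph) (a u v b c : H) (P : seq (H * H)).
Hypothesis core_uniq : uniq [:: a; u; v].
Hypotheses (b_tail : b \notin [:: a; u; v]) (c_tail : c \notin [:: a; u; v]).
Hypothesis P_tail : forall x y, (x, y) \in P -> x \notin [:: a; u; v] /\ y \notin [:: a; u; v].
Hypothesis edgeE : forall x y : H, x -- y =
  ((x, y) \in [:: (a, u); (a, v); (u, v); (u, b); (v, c)] ++ P)
  || ((y, x) \in [:: (a, u); (a, v); (u, v); (u, b); (v, c)] ++ P).

(** [P] stands for the path edges away from the triangle, one path for a house and two for a bull,
    so both cases share this computation. *)
Lemma core_edges :
  [/\ forall k, a -- k = (k \in [:: u; v]),
      forall k, u -- k = (k \in [:: a; v; b]),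
      forall k, v -- k = (k \in [:: a; u; c])
    & forall h l, h \notin [:: a; u; v] ->
        h -- l = [|| (h == b) && (l == u), (h == c) && (l == v), (h, l) \in P | (l, h) \in P]].
Proof.
have Pl x y : x \in [:: a; u; v] -> ((x, y) \in P) = false.
  by move=> xc; apply/negP => /P_tail[/negP].
have Pr x y : x \in [:: a; u; v] -> ((y, x) \in P) = false.
  by move=> xc; apply/negP => /P_tail[_ /negP].
move: core_uniq b_tail c_tail; rewrite /= !inE !negb_or andbT.
case/andP=> /andP[/negPf au /negPf av] /negPf uv.
case/and3P=> /negPf ba /negPf bu /negPf bv /and3P[/negPf ca /negPf cu /negPf cv].
have E := (au, av, uv, ba, bu, bv, ca, cu, cv).
have E' := (eq_sym u a, eq_sym v a, eq_sym v u, eq_sym a b, eq_sym u b, eq_sym v b,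
            eq_sym a c, eq_sym u c, eq_sym v c).
split=> [k|k|k|h l].
- by rewrite edgeE !mem_cat !inE !xpair_eqE Pl ?Pr ?inE ?eqxx // !E' !E /=; do !case: eqP.
- by rewrite edgeE !mem_cat !inE !xpair_eqE Pl ?Pr ?inE ?eqxx ?orbT // !E' !E /=; do !case: eqP.
- by rewrite edgeE !mem_cat !inE !xpair_eqE Pl ?Pr ?inE ?eqxx ?orbT // !E' !E /=; do !case: eqP.
- move=> hc; have /norP[/negPf ha /norP[/negPf hu /negPf hv]] :
      ~~ [|| h == a, h == u | h == v] by move: hc; rewrite !inE.
  rewrite edgeE !mem_cat !inE !xpair_eqE ha hu hv /= !andbF /= [(l == u) && _]andbC.
  rewrite [(l == v) && _]andbC orbC -!orbA; do 2 congr (_ || _);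
    exact: orbC.
Qed.

End Core.

(** Weights grow along [R] from [b] to [c], so everything is pushed towards [u]; the edge [vc] just
    makes [v] the second neighbour of [c]. That [R] has more than one vertex gives [b != c]. *)
Lemma house_hanging_triangle (H : sgraph) : generalized_house H ->
  exists (a u v b c : H) wt, hanging_triangle a u v b c wt.
Proof.
case=> a [u [v [b [R' [sR [uniq_vs vsT edgeE]]]]]].
set R := b :: R' in sR uniq_vs vsT edgeE; set c := last b R' in edgeE.
move: uniq_vs; rewrite -[_ :: _]/([:: a; u; v] ++ R) cat_uniq => /and3P[cu /hasPn dis uR].
have bR : b \in R := mem_head _ _.
have cR : c \in R := mem_last _ _.
have iR l : l \in R -> index l R < size R by rewrite index_mem.
have Pt x y : (x, y) \in path_edges R -> x \notin [:: a; u; v] /\ y \notin [:: a; u; v].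
  by case/path_edges_mem => // /dis xc /dis yc.
have [ea eu ev et] := core_edges cu (dis _ bR) (dis _ cR) Pt edgeE.
have ic : index c R = (size R).-1.
  by rewrite /c (last_nth b) -[nth b (b :: R') _]/(nth b R (size R')) index_uniq.
have bc : b != c.
  by apply/eqP => bc; move: ic sR; rewrite -bc /= eqxx; lia.
pose wt l := if l \in R then (index l R).+1 else 0.
exists a, u, v, b, c, wt; split=> //.
  rewrite -[[:: a; _; _; _; _]]/([:: a; u; v] ++ [:: b; c]) cat_uniq cu andTb.
  apply/andP; split; last by rewrite /= inE bc.
  by apply/hasPn => x; rewrite mem_seq2 => /orP[]/eqP->; apply: dis.
have vs_all h : h \notin [:: a; u; v] -> h \in R.
  by move=> hc; have := vsT h; rewrite -[_ :: _]/([:: a; u; v] ++ R) mem_cat (negPf hc).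
have wtN l : l \in [:: a; u; v] -> wt l = 0.
  by move=> lc; rewrite /wt; case: ifP => // /dis; rewrite lc.
have Nu : u \in [:: a; u; v] by rewrite !inE eqxx orbT.
have Nv : v \in [:: a; u; v] by rewrite !inE eqxx !orbT.
move=> h hc; have hR := vs_all _ hc.
have wh : wt h = (index h R).+1 by rewrite /wt hR.
pose k := if h == c then v else nth b R (index h R).+1.
have nextE l : (h, l) \in path_edges R -> l = k.
  move=> hl; rewrite /k ifN; first exact: path_edges_next.
  have [_ /iR] := path_edges_mem uR hl; move: hl; rewrite mem_path_edges //.
  by case/andP=> _ /eqP-> lt; apply: contraTneq lt => ->; rewrite ic; lia.
have [hb|hb] := eqVneq h b.
  exists u, k; split.
  - by rewrite wh wtN.
  - by rewrite et // hb !eqxx.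
  - move=> l; rewrite et // => /or4P[/andP[_ /eqP]|/andP[hc' /eqP->]|/nextE|].
    + by left.
    + by right; rewrite /k hc'.
    + by right.
    + by rewrite mem_path_edges // hb /= eqxx andbF.
have i0 : 0 < index h R.
  by rewrite lt0n; apply: contraNneq hb => i0; rewrite -(nth_index b hR) i0.
pose p := nth b R (index h R).-1.
have ph : (p, h) \in path_edges R.
  by rewrite -(nth_index b hR) -(prednK i0) path_edges_nth // prednK // iR.
have [pR _] := path_edges_mem uR ph.
have ip : index h R = (index p R).+1.
  by apply/eqP; move: ph; rewrite mem_path_edges // => /andP[].
exists p, k; split.
- by rewrite wh /wt pR ip.
- by rewrite et // ph !orbT.
- move=> l; rewrite et // (negPf hb) => /or4P[//|/andP[hc' /eqP->]|/nextE|].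
  + by right; rewrite /k hc'.
  + by right.
  + by move/(path_edges_prev b uR); left.
Qed.

(** Each path is pushed towards its own vertex of the triangle: weights increase along [Rb], which
    starts next to [u], and decrease along [Rc], which ends next to [v]. *)
Lemma bull_hanging_triangle (H : sgraph) : generalized_bull H ->
  exists (a u v b c : H) wt, hanging_triangle a u v b c wt.
Proof.
case=> a [u [v [b [d [Rb' [Rc' [uniq_vs vsT edgeE]]]]]]].
set Rb := b :: Rb' in uniq_vs vsT edgeE; set Rc := d :: Rc' in uniq_vs vsT edgeE.
set c := last d Rc' in edgeE.
move: uniq_vs; rewrite -[_ :: _]/([:: a; u; v] ++ Rb ++ Rc) cat_uniq.
case/and3P=> cu /hasPn dis uR; move: uR; rewrite cat_uniq => /and3P[uRb /hasPn disR uRc].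
have bR : b \in Rb := mem_head _ _.
have cR : c \in Rc := mem_last _ _.
have disb x : x \in Rb -> x \notin [:: a; u; v].
  by move=> xb; apply: dis; rewrite mem_cat xb.
have disc x : x \in Rc -> x \notin [:: a; u; v].
  by move=> xc; apply: dis; rewrite mem_cat xc orbT.
have bNc x : x \in Rb -> x \in Rc -> False by move=> xb /disR/negP.
have Pt x y : (x, y) \in path_edges Rb ++ path_edges Rc ->
    x \notin [:: a; u; v] /\ y \notin [:: a; u; v].
  by rewrite mem_cat => /orP[]/path_edges_mem[] // xR yR; split; auto.
have [ea eu ev et] := core_edges cu (disb _ bR) (disc _ cR) Pt edgeE.
have ic : index c Rc = (size Rc).-1.
  by rewrite /c (last_nth d) -[nth d (d :: Rc') _]/(nth d Rc (size Rc')) index_uniq.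
have bc : b != c by apply/eqP => bc; apply: (bNc b) => //; rewrite bc.
pose wt l := if l \in Rb then (index l Rb).+1 else if l \in Rc then size Rc - index l Rc else 0.
have wtb l : l \in Rb -> wt l = (index l Rb).+1 by rewrite /wt => ->.
have wtc l : l \in Rc -> wt l = size Rc - index l Rc.
  by move=> lc; rewrite /wt lc; case: ifP => // /bNc[].
exists a, u, v, b, c, wt; split=> //.
  rewrite -[[:: a; _; _; _; _]]/([:: a; u; v] ++ [:: b; c]) cat_uniq cu andTb.
  apply/andP; split; last by rewrite /= inE bc.
  by apply/hasPn => x; rewrite mem_seq2 => /orP[]/eqP->; auto.
have wtN l : l \in [:: a; u; v] -> wt l = 0.
  by move=> lc; rewrite /wt; case: ifP => [/disb|_]; [|case: ifP => // /disc]; rewrite lc.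
have Nu : u \in [:: a; u; v] by rewrite !inE eqxx orbT.
have Nv : v \in [:: a; u; v] by rewrite !inE eqxx !orbT.
move=> h hc.
have Pb l m : l \in Rb -> ((l, m) \in path_edges Rc = false) * ((m, l) \in path_edges Rc = false).
  by move=> lb; split; apply/negP => /path_edges_mem[] // l1 l2; apply: (bNc l).
have Pc l m : l \in Rc -> ((l, m) \in path_edges Rb = false) * ((m, l) \in path_edges Rb = false).
  by move=> lb; split; apply/negP => /path_edges_mem[] // l1 l2; apply: (bNc l).
have hR : (h \in Rb) || (h \in Rc).
  by have := vsT h; rewrite -[_ :: _]/([:: a; u; v] ++ Rb ++ Rc) !mem_cat (negPf hc).
case/orP: hR => hR.
  have hNc : (h == c) = false by apply/eqP => e; apply: (bNc h) => //; rewrite e.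
  have et' l : h -- l = [|| (h == b) && (l == u), (h, l) \in path_edges Rb
                          | (l, h) \in path_edges Rb].
    by rewrite et // hNc andFb orFb !mem_cat !(Pb _ _ hR) !orbF.
  (* At the end of [Rb] this is the default [b]; the last vertex has no further neighbour to
     name. *)
  pose k := nth b Rb (index h Rb).+1.
  have [hb|hb] := eqVneq h b.
    exists u, k; split.
    - by rewrite (wtb h) ?wtN.
    - by rewrite et' hb !eqxx.
    - move=> l; rewrite et' => /or3P[/andP[_ /eqP]|/(path_edges_next b uRb)|].
      + by left.
      + by right.
      + by rewrite mem_path_edges // hb /= eqxx andbF.
  have i0 : 0 < index h Rb.
    by rewrite lt0n; apply: contraNneq hb => i0; rewrite -(nth_index b hR) i0.
  pose p := nth b Rb (index h Rb).-1.
  have ph : (p, h) \in path_edges Rb.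
    by rewrite -(nth_index b hR) -(prednK i0) path_edges_nth // prednK // index_mem.
  have [pR _] := path_edges_mem uRb ph.
  have ip : index h Rb = (index p Rb).+1.
    by apply/eqP; move: ph; rewrite mem_path_edges // => /andP[].
  exists p, k; split.
  - by rewrite !wtb // ip.
  - by rewrite et' ph !orbT.
  - move=> l; rewrite et' (negPf hb) => /or3P[//|/(path_edges_next b uRb)|].
      by right.
    by move/(path_edges_prev b uRb); left.
have hNb : (h == b) = false by apply/eqP => e; apply: (bNc b) => //; rewrite -e.
have et' l : h -- l = [|| (h == c) && (l == v), (h, l) \in path_edges Rc
                        | (l, h) \in path_edges Rc].
  by rewrite et // hNb andFb orFb !mem_cat !(Pc _ _ hR) !orFb.
(* At the head of [Rc] the truncated predecessor gives [h] itself, a dummy, as no vertex precedes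
   it. *)
pose k := nth d Rc (index h Rc).-1.
have ih : index h Rc < size Rc by rewrite index_mem.
have [hc'|hc'] := eqVneq h c.
  exists v, k; split.
  - by rewrite (wtc h) // wtN // subn_gt0.
  - by rewrite et' hc' !eqxx.
  - move=> l; rewrite et' => /or3P[/andP[_ /eqP]||/(path_edges_prev d uRc)].
    + by left.
    + move=> hl; have [_] := path_edges_mem uRc hl; rewrite -index_mem.
      by move: hl; rewrite mem_path_edges // => /andP[_ /eqP->]; rewrite hc' ic ltnn.
    + by right.
have ih' : (index h Rc).+1 < size Rc.
  rewrite ltn_neqAle ih andbT; apply: contraNneq hc' => e.
  by rewrite -(nth_index d hR) -(nth_index d cR) ic -e.
pose p := nth d Rc (index h Rc).+1.
have ph : (h, p) \in path_edges Rc.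
  by rewrite -(nth_index d hR) path_edges_nth.
have [_ pR] := path_edges_mem uRc ph.
have ip : index p Rc = (index h Rc).+1.
  by apply/eqP; move: ph; rewrite mem_path_edges // => /andP[].
exists p, k; split.
- by rewrite !wtc // ip ltn_sub2l.
- by rewrite et' ph !orbT.
- move=> l; rewrite et' (negPf hc') => /or3P[//|/(path_edges_next d uRc)|].
    by left.
  by move/(path_edges_prev d uRc); right.
Qed.

Theorem theorem1p2 (H : sgraph)
    (hH : generalized_house H \/ generalized_bull H) :
  polynomial_time graph_encoding (fun G : sgraph => induced_minor H G).
Proof.
case: hH => [/house_hanging_triangle|/bull_hanging_triangle];
  by case=> a [u [v [b [c [wt]]]]]; apply: hanging_triangle_polynomial.
Qed.
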